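(* Suppose that $F\in\operatorname{dom}(D)$ is such that $\mathbb{E}[F]=0$, and let $Z\sim N(0,1)$. Then $$d_{\mathcal W}(F,Z)\leq\sqrt{\frac{2}{\pi}}\;\mathbb{E}\Bigl|1-\sum_{k=1}^\infty D_k(-L^{-1}F)\,D_kF\Bigr|+\sum_{k=1}^\infty\mathbb{E}\Bigl[\bigl|D_k(-L^{-1}F)\bigr|\,(D_kF)^2\Bigr]$$ and $$d_{\mathcal K}(F,Z)\leq\mathbb{E}\Bigl|1-\sum_{k=1}^\infty D_k(-L^{-1}F)\,D_kF\Bigr|+2\sum_{k=1}^\infty\mathbb{E}\Bigl|\bigl(D_k|D_kL^{-1}F|\bigr)\,D_kF\Bigr|+2\,\mathbb{E}\Bigl|\sum_{k=1}^\infty\mathbb{E}\bigl[|D_kL^{-1}F|\,\big|\,\mathcal{G}_k\bigr]\,D_kF\Bigr|.$$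
   Context: Let $\mathbb{X}=(X_n)_{n\in\mathbb{N}}$ be a sequence of independent random variables on a probability space $(\Omega,\mathcal{A},\mathbb{P})$, $X_n$ taking values in an arbitrary measurable space. Let $\mathcal{F}=\sigma(\mathbb{X})$, $\mathcal{F}_M=\sigma(X_j:j\in M)$, $\mathcal{F}_n=\mathcal{F}_{\{1,\dotsc,n\}}$, $\mathcal{G}_k=\sigma(X_j:j\neq k)$, $L^r_{\mathbb{X}}=L^r(\Omega,\mathcal{F},\mathbb{P})$; $\kappa$ is counting measure on $\mathbb{N}$, $\mathbb{P}_{\mathcal F}$ the restriction of $\mathbb{P}$ to $\mathcal{F}$. For $F\in L^1_{\mathbb{X}}$, $D_kF:=F-\mathbb{E}[F\mid\mathcal{G}_k]$. On the space of all $F\in L^2_{\mathbb{X}}$ that are $\mathcal{F}_n$-measurable for some $n$, put $DF:=(D_kF)_{k\in\mathbb{N}}\in L^2(\kappa\otimes\mathbb{P}_{\mathcal F})$; this is closable, its closure is denoted $D$ with domain $\operatorname{dom}(D)\subseteq L^2_{\mathbb{X}}$. With $\delta$ the Hilbert space adjoint of $D$, put $\operatorname{dom}(L)=\{F\in\operatorname{dom}(D):DF\in\operatorname{dom}(\delta)\}$ and $LF:=-\delta DF$. Pseudo-inverse: for $G\in L^2_{\mathbb{X}}$ with $\mathbb{E}[G]=0$, $L^{-1}G$ is the unique centered element of $\operatorname{dom}(L)$ with $L(L^{-1}G)=G$. Explicitly, $L^{-1}G=-\sum_{\emptyset\neq M\subseteq\mathbb{N}\text{ finite}}|M|^{-1}G_M$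 (unconditionally in $L^2(\mathbb{P})$), where $G_M=\sum_{K\subseteq M}(-1)^{|M|-|K|}\mathbb{E}[G\mid\mathcal{F}_K]$. Distances: $d_{\mathcal W}(Y,W)=\sup_h|\mathbb{E}[h(Y)]-\mathbb{E}[h(W)]|$ over all $1$-Lipschitz $h:\mathbb{R}\to\mathbb{R}$; $d_{\mathcal K}(Y,W)=\sup_{z\in\mathbb{R}}|\mathbb{P}(Y\le z)-\mathbb{P}(W\le z)|$. The right-hand sides of the bounds may be $+\infty$. *)

(* Defs.v *)
From mathcomp Require Import all_boot all_order all_algebra finmap.
From mathcomp Require Import all_classical all_reals all_analysis.
Import numFieldNormedType.Exports.

Set Implicit Arguments.
Unset Strict Implicit.
Unset Printing Implicit Defensive.

Import Order.TTheory GRing.Theory Num.Theory.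

Local Open Scope classical_set_scope.
Local Open Scope ring_scope.
Local Open Scope ereal_scope.

(* Square-integrable functionals are represented by functions, not by classes
   modulo almost sure equality; "measurable with respect to the sigma-algebra
   generated by G" is measurability on [g_sigma_algebraType G].  Unbounded
   operators are represented by their graphs. *)

Section conditional_expectation.
Context d (T : measurableType d) (R : realType) (P : probability T R).

Definition is_condE (G : set (set T)) (Y Z : T -> R) : Prop :=
  [/\ measurable_fun [set: g_sigma_algebraType G] (Z : g_sigma_algebraType G -> R),
      Z \in Lfun P 1 &
      forall A, <<s G >> A ->
        \int[P]_(w in A) (Z w)%:E = \int[P]_(w in A) (Y w)%:E].

(* A chosen version of the conditional expectation of Y given <<s G>>; the
   default value is irrelevant, as a version exists for every integrable Y. *)
Definition condE (G : set (set T)) (Y : T -> R) : T -> R :=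
  xget (cst 0%R) [set Z | is_condE G Y Z].

End conditional_expectation.

Section independent_sequence.
Context d (T : measurableType d) (R : realType) (P : probability T R).
Context (dE : nat -> measure_display) (E : forall n, measurableType (dE n)).
Context (X : forall n, {RV P >-> E n}).

Definition independent_seq : Prop :=
  forall (J : {fset nat}) (A : forall n, set (E n)),
    (forall n, measurable (A n)) ->
    P (\bigcap_(j in [set` J]) (X j @^-1` A j)) =
    \prod_(j <- J) P (X j @^-1` A j).

(* Generates the sigma-algebra of the X j, j in M. *)
Definition sigmaX (M : set nat) : set (set T) :=
  \bigcup_(j in M) preimage_set_system setT (X j) measurable.

Definition measurable_wrt (M : set nat) (F : T -> R) : Prop :=
  measurable_fun [set: g_sigma_algebraType (sigmaX M)]
    (F : g_sigma_algebraType (sigmaX M) -> R).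

Definition L2X (F : T -> R) : Prop :=
  measurable_wrt setT F /\ F \in Lfun P 2%:E.

Definition condE_G (k : nat) (F : T -> R) : T -> R :=
  condE P (sigmaX [set j | j <> k]) F.

Definition Dk (k : nat) (F : T -> R) : T -> R := (F \- condE_G k F)%R.

(* The space L^2(kappa (x) P_F): as kappa is the counting measure on nat, a
   measurable function on the product is a sequence of measurable functions and
   integration against kappa is summation over the first coordinate. *)
Definition sqnorm_seq (U : nat -> T -> R) : \bar R :=
  \sum_(k <oo) 'E_P[fun w => (U k w ^+ 2)%R].

Definition dot_seq (U V : nat -> T -> R) : \bar R :=
  \sum_(k <oo) 'E_P[fun w => (U k w * V k w)%R].

Definition L2seq (U : nat -> T -> R) : Prop :=
  (forall k, measurable_wrt setT (U k)) /\ sqnorm_seq U < +oo.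

Definition cylindrical (F : T -> R) : Prop :=
  L2X F /\ exists n, measurable_wrt [set j | (j < n)%N] F.

(* The graph of D, that is, the closure in L^2_X x L^2(kappa (x) P_F) of
   { (F, (Dk k F)_k) | F cylindrical }. *)
Definition is_D (F : T -> R) (U : nat -> T -> R) : Prop :=
  [/\ L2X F, L2seq U &
      exists Fn : nat -> T -> R,
        [/\ forall n, cylindrical (Fn n),
            'E_P[fun w => ((Fn n w - F w) ^+ 2)%R] @[n --> \oo] --> 0 &
            sqnorm_seq (fun k => Dk k (Fn n) \- U k)%R @[n --> \oo] --> 0]].

Definition dom_D (F : T -> R) : Prop := exists U, is_D F U.

(* The graph of delta, the adjoint of D. *)
Definition is_delta (U : nat -> T -> R) (G : T -> R) : Prop :=
  [/\ L2seq U, L2X G &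
      forall F V, is_D F V -> dot_seq V U = 'E_P[fun w => (F w * G w)%R]].

(* The graph of L = - delta D. *)
Definition is_L (F G : T -> R) : Prop :=
  exists U, is_D F U /\ is_delta U (\- G)%R.

(* H is (a version of) the pseudo-inverse of L at G: the centered element of
   dom(L) mapped to G. *)
Definition is_Linv (G H : T -> R) : Prop := 'E_P[H] = 0 /\ is_L H G.

End independent_sequence.

Arguments condE {d T R} P G Y _.
Arguments independent_seq {d T R} P {dE E} X.
Arguments condE_G {d T R} P {dE E} X k F _.
Arguments Dk {d T R} P {dE E} X k F _.
Arguments dom_D {d T R} P {dE E} X F.
Arguments is_Linv {d T R} P {dE E} X G H.

(* The two variables of a distance may live on different probability spaces. *)
Section distances.
Context (R : realType).
Context d (T : measurableType d) (P : probability T R) (Y : T -> R).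
Context d' (T' : measurableType d') (Q : probability T' R) (W : T' -> R).

Definition dWasserstein : \bar R :=
  ereal_sup [set `| 'E_P[h \o Y] - 'E_Q[h \o W] |
            | h in [set h : R -> R | 1.-lipschitz h]].

Definition dKolmogorov : \bar R :=
  ereal_sup [set `| P [set w | (Y w <= z)%R] - Q [set w | (W w <= z)%R] |
            | z in [set: R]].

End distances.

Arguments dWasserstein {R d T} P Y {d' T'} Q W.
Arguments dKolmogorov {R d T} P Y {d' T'} Q W.

(* Main.v *)
(** Stein's method. For a Lipschitz function [f], the chain [f \o F] is again in
    the domain of [D], with [D_k (f \o F)] the [k]-th difference; since
    [F = - delta D L^-1 F], duality gives
    [E [F f(F)] = sum_k E [(f(F) - f(E[F | G_k])) D_k(- L^-1 F)]], where
    [F - E[F | G_k] = D_k F]. The bounds follow by a first order expansion of the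
    increments of a solution [f] of the Stein equation
    [f'(x) - x f(x) = h(x) - E h(Z)]. For Wasserstein, [h] is first smoothed, and
    [|f'| <= sqrt (2 / pi)], [|f''| <= 2]. For Kolmogorov, [h] is the indicator of
    [x <= z], the error of the expansion is at most [D_k F (g(F) - g(E[F | G_k]))]
    with [g(x) = x f(x) - 1_{x <= z}] nondecreasing, and
    [|D_k L^-1 F| = D_k |D_k L^-1 F| + E[|D_k L^-1 F| | G_k]]; the product of the
    last term with [g(E[F | G_k])] is [G_k]-measurable, hence orthogonal to
    [D_k F]. *)
Require Import Defs.
From HB Require Import structures.
From mathcomp Require Import all_boot all_order all_algebra finmap.
From mathcomp Require Import all_classical all_reals all_analysis measurable_realfun.
From mathcomp Require Import ring lra.
Import numFieldNormedType.Exports.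
Import Order.TTheory GRing.Theory Num.Theory.

Set Implicit Arguments.
Unset Strict Implicit.
Unset Printing Implicit Defensive.

Local Open Scope classical_set_scope.
Local Open Scope ring_scope.

(** The sharp constant [sqrt (2 / pi)] for [|f'|] is the delicate analytic point. With [Psi x] the
    expectation of the positive part of [x - N], the function [f' phi] is a difference of two terms,
    each at most [Psi x * Psi (- x)], so the ratio [Psi x * Psi (- x) / phi x] must be shown to be
    largest at 0. Its reciprocal is a sum of two logarithmic derivatives, and their Riccati
    equations make a critical point argument possible. On the probabilistic side, [D] is a closure,
    so the chain [f \o F] needs a limit in the space of square-summable sequences. The element
    [D_k (f \o F)] is not [f(F) - f(E[F | G_k])]; they differ by a [G_k]-measurable function, which
    is orthogonal to [D_k L^-1 F]. The same [f(E[F | G_k])], taken as a competitor in the best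
    approximation of [f(F)], bounds the norm of [D_k (f \o F)] by that of [D_k F]. Conditional
    expectations are chosen versions, so even [D_k (- H) = - D_k H] holds only almost everywhere;
    this is expressed by a vanishing square norm. All estimates are made for partial sums and passed
    to the limit afterwards, as the remainders may sum to infinity. *)

Section calculus.
Context {R : realType}.
Implicit Types (f df ddf : R -> R) (x : R).

Lemma is_derive_nondecreasing f df (b : R) :
  (forall x, x < b -> is_derive x 1 f (df x)) -> (forall x, x < b -> 0 <= df x) ->
  forall x y, x <= y -> y < b -> f x <= f y.
Proof.
move=> fdf df0 x y xy yb.
have [| |c cxy fyx] := @MVT_segment R f df x y xy.
- move=> z; rewrite in_itv/= => /andP[_ zy]; exact/fdf/(lt_trans zy).
- apply: derivable_within_continuous => z; rewrite in_itv/= => /andP[_ zy].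
  by have [] := fdf z (le_lt_trans zy yb).
- rewrite -subr_ge0 fyx mulr_ge0 ?subr_ge0// df0//.
  by rewrite (le_lt_trans _ yb)// (itvP cxy).
Qed.

(** Stands in for integration from [-oo]: a sign of the derivative and a limit give a pointwise
    bound. The half-line below [b] admits functions with a pole, such as [phi y / y]. *)
Lemma is_derive_ge0_cvgNy f df (b l : R) :
  (forall x, x < b -> is_derive x 1 f (df x)) -> (forall x, x < b -> 0 <= df x) ->
  f x @[x --> -oo] --> l -> forall x, x < b -> l <= f x.
Proof.
move=> fdf df0 fl x xb.
have <- : lim (f t @[t --> -oo]) = l by apply/cvg_lim.
apply: limr_le; first by apply/cvg_ex; exists l.
near=> t; by apply: (is_derive_nondecreasing fdf df0).
Unshelve. all: by end_near. Qed.

(** Two mean values: [f t - f a] is [df c * (t - a)], and [df c] is [ddf c' * (c - a)] with [c'] so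
    close to [a] that [ddf c'] is positive. *)
Lemma local_min_right f df ddf (a : R) :
  (forall x, is_derive x 1 f (df x)) -> (forall x, is_derive x 1 df (ddf x)) ->
  {for a, continuous ddf} -> df a = 0 -> 0 < ddf a ->
  \forall t \near a^'+, f a < f t.
Proof.
move=> fdf dfddf ca dfa ddfa.
have [e/= e0 He] : \forall z \near a, 0 < ddf z by exact: (cvgr_gt _ ca).
near=> t.
have tae : t < a + e by near: t; apply: nbhs_right_lt; rewrite ltrDl.
have at_ : a < t by [].
have [|c cat ft] := MVT at_ (fun x _ => fdf x).
- by apply: derivable_within_continuous => z _; have [] := fdf z.
have ac : a < c by rewrite (itvP cat).
have ct : c < t by rewrite (itvP cat).
have [|c' cac dfc] := MVT ac (fun x _ => dfddf x).
- by apply: derivable_within_continuous => z _; have [] := dfddf z.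
have ac' : a < c' by rewrite (itvP cac).
have c't : c' < c by rewrite (itvP cac).
rewrite -subr_gt0 ft mulr_gt0 ?subr_gt0//.
rewrite dfa subr0 in dfc; rewrite dfc mulr_gt0 ?subr_gt0//.
apply: He; rewrite /ball/= distrC ger0_norm; lra.
Unshelve. all: by end_near. Qed.

End calculus.

(** * The standard normal density and distribution function *)

Section gaussian.
Context {R : realType}.
Notation mu := (@lebesgue_measure R).

Definition phi (x : R) : R := normal_pdf 0 1 x.
Definition Phi (x : R) : R := \int[mu]_(t in `]-oo, x]) phi t.

Lemma phiE (x : R) : phi x = (Num.sqrt (2 * pi))^-1 * expR (- (x ^+ 2 / 2)).
Proof.
rewrite /phi normal_pdfE ?oner_eq0// /normal_peak /normal_fun subr0 expr1n.
by rewrite mul1r mulNr -mulr_natl.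
Qed.

Lemma phi_gt0 (x : R) : 0 < phi x.
Proof. by rewrite phiE mulr_gt0 ?expR_gt0// invr_gt0 sqrtr_gt0 mulr_gt0 ?pi_gt0. Qed.

Lemma phi_neq0 (x : R) : phi x != 0. Proof. by rewrite gt_eqF// phi_gt0. Qed.

Lemma phiN (x : R) : phi (- x) = phi x. Proof. by rewrite !phiE sqrrN. Qed.

Lemma continuous_phi : continuous phi.
Proof. by apply: continuous_normal_pdf; rewrite oner_eq0. Qed.

Lemma is_derive_phi (x : R) : is_derive x 1 phi (- x * phi x).
Proof.
rewrite (_ : phi = fun x => (Num.sqrt (2 * pi))^-1 * expR (- (x ^+ 2 / 2))); last first.
  by apply/funext => y; rewrite phiE.
apply: is_derive_eq; rewrite /GRing.scale/=.
by field; rewrite sqrtr_eq0 -ltNge mulr_gt0 ?pi_gt0.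
Qed.

Lemma integrable_phi A : measurable A -> mu.-integrable A (EFin \o phi).
Proof.
by move=> mA; apply: integrableS (integrable_normal_pdf _ _).
Qed.

Lemma Phi_normal_prob (x : R) : (Phi x)%:E = normal_prob 0 1 `]-oo, x].
Proof.
rewrite /Phi /Rintegral fineK//.
by apply: integrable_fin_num => //; exact: integrable_phi.
Qed.

Lemma is_derive_Phi (x : R) : is_derive x 1 Phi (phi x).
Proof.
have xx1 : x < x + 1 by rewrite ltrDl.
have [dP eP] := continuous_FTC1 xx1 (integrable_phi (measurable_itv `]-oo, x + 1])) (ltNyr _) (@continuous_phi x).
by apply: DeriveDef; [exact: dP|rewrite -derive1E; exact: eP].
Qed.

(** The identity as a random variable under the normal law; its distribution function is [Phi],
    whence the limits of [Phi] at both ends. *)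
Let idTR : measurableTypeR R -> R := idfun.

#[local] HB.instance Definition _ :=
  @isMeasurableFun.Build _ _ _ _ idTR (@measurable_id _ _ setT).

Lemma cvg_PhiNy : Phi x @[x --> -oo] --> (0 : R).
Proof.
have /fine_cvgP[_] := cvg_cdfNy0 (idTR : {RV (@normal_prob R 0 1) >-> R}).
by apply: cvg_trans; apply: near_eq_cvg; apply: nearW => x.
Qed.

Lemma cvg_Phiy : Phi x @[x --> +oo] --> (1 : R).
Proof.
have /fine_cvgP[_] := cvg_cdfy1 (idTR : {RV (@normal_prob R 0 1) >-> R}).
by apply: cvg_trans; apply: near_eq_cvg; apply: nearW => x.
Qed.

(** The sum [Phi x + Phi (- x)] has derivative 0, and its constant value is its limit at [+oo]. *)
Lemma PhiN (x : R) : Phi (- x) = 1 - Phi x.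
Proof.
have dS (z : R) : is_derive z 1 (fun y => Phi y + Phi (- y)) 0.
  have ? := is_derive_Phi z.
  have dN : is_derive z 1 (Phi \o -%R) (phi (- z) * -1).
    apply: is_derive1_comp; exact: is_derive_Phi.
  by apply: is_derive_eq; rewrite phiN; ring.
have cS z : Phi x + Phi (- x) = Phi z + Phi (- z).
  exact: (is_derive_0_is_cst x z dS).
have lS : Phi z + Phi (- z) @[z --> +oo] --> (1 + 0 : R).
  apply: cvgD; first exact: cvg_Phiy.
  by move: cvg_PhiNy; rewrite cvgNy_compNP.
have lC : Phi z + Phi (- z) @[z --> +oo] --> Phi x + Phi (- x).
  by under eq_fun do rewrite -cS; exact: cvg_cst.
have := cvg_unique _ lS lC.
by rewrite addr0 => ->//; ring.
Qed.



Lemma cvg_phiNy : phi x @[x --> -oo] --> (0 : R).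
Proof.
pose c : R := (Num.sqrt (2 * pi))^-1.
have c0 : 0 <= c by rewrite invr_ge0 sqrtr_ge0.
have cl : c * expR x @[x --> -oo] --> c * 0.
  by apply: cvgM; [exact: cvg_cst|rewrite cvgNy_compNP; exact: cvgr_expR].
rewrite mulr0 in cl; apply: (squeeze_cvgr _ (cvg_cst 0) cl).
  near=> x; rewrite ltW ?phi_gt0//= phiE ler_wpM2l// ler_expR.
  (* For [x <= -2] one has [- (x ^+ 2 / 2) <= x], so the density is below a multiple of [expR x]. *)
  have : x <= -2 by near: x; exact: nbhs_ninfty_le.
  by move=> x2; nra.
Unshelve. all: by end_near. Qed.

(** The lower Mills ratio bound. The function [f] below tends to 0 at [-oo], and its derivative
    simplifies to the positive [df]. *)
Lemma Phi_lower (x : R) : - (x * phi x) <= (1 + x ^+ 2) * Phi x.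
Proof.
have q0 (y : R) : 0 < 1 + y ^+ 2 by rewrite ltr_pwDl// sqr_ge0.
have qn0 (y : R) : 1 + y ^+ 2 != 0 by rewrite gt_eqF.
pose f y := Phi y + y * phi y / (1 + y ^+ 2).
pose df y := 2 * phi y / (1 + y ^+ 2) ^+ 2.
have fdf (y : R) : is_derive y 1 f (df y).
  have ? := is_derive_Phi y; have ? := is_derive_phi y.
  have -> : f = Phi \+ ((id \* phi) \* (fun y => (1 + y ^+ 2)^-1)) by [].
  have ? : is_derive y 1 (fun y : R => 1 + y ^+ 2) (2 * y).
    by apply: is_derive_eq; rewrite /GRing.scale/=; ring.
  have ? : is_derive y 1 (fun y : R => (1 + y ^+ 2)^-1) (- (1 + y ^+ 2) ^- 2 *: (2 * y)).
    exact: is_deriveV.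
  by apply: is_derive_eq; rewrite /df /GRing.scale/=; field.
have fl : f y @[y --> -oo] --> (0 : R).
  rewrite -[X in _ --> X]addr0; apply: cvgD; first exact: cvg_PhiNy.
  apply/cvgr0Pnorm_le => e e0.
  have /cvgr0Pnorm_le/(_ e e0) := cvg_phiNy.
  apply: filterS => y; apply: le_trans.
  rewrite !normrM normfV (ger0_norm (ltW (q0 y))) ler_pdivrMr//.
  rewrite mulrC ler_wpM2l//.
  by rewrite -real_normK ?num_real//; have := normr_ge0 y; nra.
have := @is_derive_ge0_cvgNy _ f df (x + 1) 0 (fun y _ => fdf y) _ fl x.
rewrite ltrDl => /(_ _ ltr01) fx.
have {fx} : 0 <= f x.
  by apply: fx => y _; rewrite divr_ge0 ?sqr_ge0// mulr_ge0// ltW// phi_gt0.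
rewrite -(pmulr_rge0 _ (q0 x)) /f.
rewrite -[in X in _ -> X]subr_ge0 opprK; congr (0 <= _).
by field.
Qed.

Lemma Phi_gt0 (x : R) : 0 < Phi x.
Proof.
wlog x0 : x / x < 0.
  move=> H; have [/H//|x0] := ltP x 0.
  have {}H : 0 < Phi (-1) by apply: H; lra.
  apply: (lt_le_trans H).
  apply: (is_derive_nondecreasing (fun y _ => is_derive_Phi y) _ (b := x + 1)).
  - by move=> y _; rewrite ltW// phi_gt0.
  - lra.
  - lra.
have := Phi_lower x; have := phi_gt0 x; have := sqr_ge0 x; nra.
Qed.

Lemma Phi_lt1 (x : R) : Phi x < 1.
Proof. by have := Phi_gt0 (- x); rewrite PhiN subr_gt0. Qed.

(* [Psi x] is the expectation of the positive part of [x - N], N a standard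
   normal variable. *)
Definition Psi (x : R) : R := phi x + x * Phi x.

Lemma is_derive_Psi (x : R) : is_derive x 1 Psi (Phi x).
Proof.
have ? := is_derive_Phi x; have ? := is_derive_phi x.
by apply: is_derive_eq; rewrite /GRing.scale/=; ring.
Qed.

Lemma PsiN (x : R) : Psi (- x) = phi x - x * (1 - Phi x).
Proof. by rewrite /Psi phiN PhiN; ring. Qed.

Lemma Psi_gt0 (x : R) : 0 < Psi x.
Proof.
have ndPsi : forall x y, x <= y -> Psi x <= Psi y.
  move=> y z yz.
  apply: (is_derive_nondecreasing (fun y _ => is_derive_Psi y) _ (b := z + 1)) => //.
  - by move=> ? _; rewrite ltW// Phi_gt0.
  - lra.
have Psi0 (y : R) : y < 0 -> 0 <= Psi y.
  (* The upper Mills ratio bound: [Psi y] is [- y * f y], and [f] increases from its limit 0 at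
     [-oo]. *)
  move=> y0; pose f y := - Phi y - phi y / y; pose df y := phi y / y ^+ 2.
  have fdf (z : R) : z < 0 -> is_derive z 1 f (df z).
    move=> z0; have zN0 : z != 0 by rewrite lt_eqF.
    have ? := is_derive_Phi z; have ? := is_derive_phi z.
    have -> : f = \- Phi \- (phi \* (fun y => y^-1)) by [].
    have ? : is_derive z 1 (fun y : R => y^-1) (- z ^- 2 *: 1).
      exact: is_deriveV.
    by apply: is_derive_eq; rewrite /df /GRing.scale/=; field.
  have fl : f y @[y --> -oo] --> (0 : R).
    rewrite -[X in _ --> X]subr0; apply: cvgB.
      by rewrite -oppr0; apply: cvgN; exact: cvg_PhiNy.
    apply/cvgr0Pnorm_le => e e0.
    have /cvgr0Pnorm_le/(_ e e0) := cvg_phiNy.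
    apply: filterS2 (nbhs_ninfty_le (num_real (-1 : R))) => z z1; apply: le_trans.
    have z0 : z < 0 by lra.
    rewrite normrM ler_piMr// normfV invf_le1 ?normr_gt0 ?lt_eqF//.
    by rewrite ltr0_norm//; lra.
  have := is_derive_ge0_cvgNy fdf _ fl y0.
  have y0' : 0 < - y by rewrite oppr_gt0.
  move=> /(_ _)/wrap[z z0|]; first by rewrite divr_ge0 ?sqr_ge0// ltW// phi_gt0.
  rewrite /f -(pmulr_rge0 _ y0') => H.
  rewrite (le_trans H)// /Psi; have yN0 : y != 0 by rewrite lt_eqF.
  by rewrite le_eqVlt; apply/orP; left; apply/eqP; field.
wlog x0 : x / x < 0.
  move=> H; have [/H//|x0] := ltP x 0.
  by apply: (lt_le_trans (H (-1) _)); [lra|apply: ndPsi; lra].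
(* So far [Psi] is only nonnegative on the negative axis. Strictness comes from its derivative
   [Phi], which is positive on the unit step from [x - 1] to [x]. *)
apply: (@le_lt_trans _ _ (Psi (x - 1))); first by apply: Psi0; lra.
have [| | |c cxy] := @MVT R Psi Phi (x - 1) x.
- by lra.
- by move=> z _; exact: is_derive_Psi.
- apply: derivable_within_continuous => z _; by have [] := is_derive_Psi z.
by have := Phi_gt0 c; rewrite opprB addrCA subrr addr0; lra.
Qed.

Lemma Psi_le_phi (x : R) : x <= 0 -> Psi x <= phi x.
Proof. by move=> x0; rewrite gerDl mulr_le0_ge0// ltW// Phi_gt0. Qed.

Lemma cvg_PsiNy : Psi x @[x --> -oo] --> (0 : R).
Proof.
apply: (squeeze_cvgr _ (cvg_cst 0) cvg_phiNy).
near=> x; rewrite ltW ?Psi_gt0//= Psi_le_phi//.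
Unshelve. all: by end_near. Qed.


(** * The product inequality for [Psi x] and [Psi (- x)] *)

Implicit Types x y w : R.

(** The logarithmic derivative of [Psi]. As [Psi'' = phi = Psi - x Psi'], it satisfies a Riccati
    equation. *)
Let Y (x : R) : R := Phi x / Psi x.

Let is_derive_Y x : is_derive x 1 Y (1 - x * Y x - Y x ^+ 2).
Proof.
have ? := is_derive_Phi x; have dPsi := is_derive_Psi x.
have P0 : Psi x != 0 by rewrite gt_eqF// Psi_gt0.
have -> : Y = Phi \* (fun y => (Psi y)^-1) by [].
have ? : is_derive x 1 (fun y : R => (Psi y)^-1) (- (Psi x) ^- 2 *: Phi x).
  exact: is_deriveV.
apply: is_derive_eq; rewrite /Y /GRing.scale/=.
rewrite (_ : phi x = Psi x - x * Phi x); first by field.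
by rewrite /Psi addrK.
Qed.

(** By a Wronskian identity, [S x] is [phi x / (Psi x * Psi (- x))], so the product inequality says
    that [S] is minimal at 0. The next function, [D], is the logarithmic derivative of [S]. *)
Let S (x : R) : R := Y x + Y (- x).
Let D (x : R) : R := Y (- x) - Y x - x.

Let is_derive_YN x : is_derive x 1 (fun y => Y (- y)) (- (1 + x * Y (- x) - Y (- x) ^+ 2)).
Proof.
have dN : is_derive x 1 (Y \o -%R) ((1 - (- x) * Y (- x) - Y (- x) ^+ 2) * -1).
  by apply: is_derive1_comp; exact: is_derive_Y.
by apply: is_derive_eq; ring.
Qed.

Let is_derive_S x : is_derive x 1 S (S x * D x).
Proof.
have ? := is_derive_Y x; have ? := is_derive_YN x.
by apply: is_derive_eq; rewrite /S /D; ring.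
Qed.

(** [Y x] and [Y (- x)] are half of [S x - (D x + x)] and half of [S x + (D x + x)], so their
    Riccati equations become a closed system in [S] and [D]. *)
Let is_derive_D x :
  is_derive x 1 D ((S x ^+ 2 + D x ^+ 2 - x ^+ 2 - 6) / 2).
Proof.
have ? := is_derive_Y x; have ? := is_derive_YN x.
by apply: is_derive_eq; rewrite /S /D; field.
Qed.

Let S_gt0 x : 0 < S x.
Proof. by rewrite addr_gt0// divr_gt0 ?Phi_gt0 ?Psi_gt0. Qed.

(** Growth at infinity, which keeps the minimum in [S_min] away from the right endpoint. It is
    [Phi_lower] at [- x]. *)
Let S_ge x : x <= S x.
Proof.
rewrite /S (@le_trans _ _ (Y (- x)))//; last first.
  by rewrite lerDr divr_ge0// ltW// ?Phi_gt0 ?Psi_gt0.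
rewrite ler_pdivlMr ?Psi_gt0// /Psi.
by have := Phi_lower (- x); rewrite !phiN; nra.
Qed.

Let continuous_S : continuous S.
Proof.
move=> x; apply: differentiable_continuous; apply/derivable1_diffP.
by have [] := is_derive_S x.
Qed.

Let continuous_D : continuous D.
Proof.
move=> x; apply: differentiable_continuous; apply/derivable1_diffP.
by have [] := is_derive_D x.
Qed.

Let dSD x := S x * D x ^+ 2 + S x * ((S x ^+ 2 + D x ^+ 2 - x ^+ 2 - 6) / 2).

Let is_derive_SD x : is_derive x 1 (fun y => S y * D y) (dSD x).
Proof.
have ? := is_derive_S x; have ? := is_derive_D x.
by apply: is_derive_eq; rewrite /dSD /GRing.scale/=; field.
Qed.

Let continuous_dSD : continuous dSD.
Proof.
have cD2 : continuous (fun x => D x ^+ 2).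
  by move=> x; apply: (cvg_comp D (fun z => z ^+ 2)); [exact: continuous_D|exact: exprn_continuous].
move=> x; apply: cvgD; apply: cvgM; [exact: continuous_S|exact: cD2|exact: continuous_S|].
apply: cvgM; last exact: cvg_cst.
apply: cvgB; last exact: cvg_cst.
apply: cvgB; last exact: exprn_continuous.
apply: cvgD; last exact: cD2.
by apply: (cvg_comp S (fun z => z ^+ 2)); [exact: continuous_S|exact: exprn_continuous].
Qed.

(** If the second derivative of [S] were positive at [x], [S] would exceed [S x] immediately to the
    right. Only the right side is inspected, because the maximum may sit at the left endpoint 0. *)
Let D0_dD_le0 x y : x < y -> D x = 0 -> (forall t, x <= t <= y -> S t <= S x) ->
  S x ^+ 2 - x ^+ 2 <= 6.
Proof.
move=> xy Dx Smax; rewrite leNgt; apply/negP => dD0.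
have [t] : exists t, [&& x < t, t < y & S x < S t].
  near x^'+ => t; exists t; apply/and3P; split=> //.
  by near: t; apply: (local_min_right is_derive_S is_derive_SD (@continuous_dSD x)) => //;
    rewrite ?/dSD Dx ?mulr0//; have := S_gt0 x; nra.
by case/and3P=> xt ty; rewrite ltNge Smax// !ltW.
Unshelve. all: by end_near. Qed.

Let D0_dD_ge0 x y : x < y -> D x = 0 -> (forall t, x <= t <= y -> S x <= S t) ->
  6 <= S x ^+ 2 - x ^+ 2.
Proof.
move=> xy Dx Smin; rewrite leNgt; apply/negP => dD0.
have [t] : exists t, [&& x < t, t < y & - S x < - S t].
  near x^'+ => t; exists t; apply/and3P; split=> //.
  near: t; apply: (@local_min_right _ (fun y => - S y)
    (fun y => - (S y * D y)) (fun y => - dSD y)).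
  - by move=> z; apply: is_deriveN.
  - by move=> z; apply: is_deriveN; exact: is_derive_SD.
  - by move=> ?; apply: cvgN; exact: continuous_dSD.
  - by rewrite Dx mulr0 oppr0.
  - by rewrite /dSD Dx; have := S_gt0 x; nra.
by case/and3P=> xt ty; rewrite ltrN2 ltNge Smin// !ltW.
Unshelve. all: by end_near. Qed.

(* At a critical point [x] of [S] the sign of the second derivative is that of
   [S x ^+ 2 - x ^+ 2 - 6].  If [S w < S 0], a maximum on [[0, w]] followed by
   a lower minimum would contradict this. *)
Let S_min w : 0 <= w -> S 0 <= S w.
Proof.
move=> w0; rewrite leNgt; apply/negP => Sw.
have w_gt0 : 0 < w by rewrite lt_neqAle w0 andbT; apply: contraTneq Sw => <-; rewrite ltxx.
have [a a0w amax] := EVT_max w0 (continuous_subspaceT continuous_S).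
have Sa0 : S 0 <= S a by apply: amax; rewrite in_itv/= lexx.
have aw : a < w.
  rewrite lt_neqAle (itvP a0w) andbT; apply: contraTneq Sw => <-.
  by rewrite -leNgt.
have a_ge0 : 0 <= a by rewrite (itvP a0w).
have Da : D a = 0.
  (* At the endpoint 0 there is no interior extremum test, but [D 0 = 0] by symmetry. *)
  have [->|aneq0] := eqVneq a 0; first by rewrite /D oppr0 subrr addr0.
  have a_gt0 : 0 < a by rewrite lt_neqAle eq_sym aneq0.
  have [] := @derive1_at_max R S 0 w a w0.
  - by move=> t _; have [] := is_derive_S t.
  - by rewrite in_itv/= a_gt0.
  - by move=> t t0w; apply: amax; exact: subset_itv_oo_cc t0w.
  have [_ ->] := is_derive_S a.
  by move=> _ /eqP; rewrite mulf_eq0 gt_eqF//= => /eqP.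
have Va : S a ^+ 2 - a ^+ 2 <= 6.
  apply: (D0_dD_le0 aw Da) => t /andP[at_ tw].
  by apply: amax; rewrite in_itv/= tw (le_trans a_ge0).
(* This choice gives [S W >= W >= S 0 > S w], so a minimum on [[a, W]] is attained at neither
   end. *)
pose W := Num.max w (S 0).
have wW : w <= W by rewrite le_max lexx.
have aW : a < W by exact: lt_le_trans wW.
have SW : S 0 <= S W by rewrite (le_trans _ (S_ge W))// le_max lexx orbT.
have [b baW bmin] := EVT_min (ltW aW) (continuous_subspaceT continuous_S).
have Sb : S b <= S w by apply: bmin; rewrite in_itv/= wW ltW.
have ab : a < b.
  rewrite lt_neqAle (itvP baW) andbT; apply/negP => /eqP ab.
  by move: Sb; rewrite -ab leNgt (lt_le_trans Sw).
have bW : b < W.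
  rewrite lt_neqAle (itvP baW) andbT; apply/negP => /eqP ab'.
  by move: Sb; rewrite ab' leNgt (lt_le_trans Sw).
have Db : D b = 0.
  have [] := @derive1_at_min R S a W b (ltW aW).
  - by move=> t _; have [] := is_derive_S t.
  - by rewrite in_itv/= ab.
  - by move=> t t0w; apply: bmin; exact: subset_itv_oo_cc t0w.
  have [_ ->] := is_derive_S b.
  by move=> _ /eqP; rewrite mulf_eq0 gt_eqF//= => /eqP.
have Vb : 6 <= S b ^+ 2 - b ^+ 2.
  apply: (D0_dD_ge0 bW Db) => t /andP[bt tW].
  by apply: bmin; rewrite in_itv/= tW (le_trans (ltW ab)).
have Sba : S b < S a by rewrite (le_lt_trans Sb)// (lt_le_trans Sw).
(* From [0 <= a < b] and [0 < S b < S a], the value [S b ^+ 2 - b ^+ 2] is strictly below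
   [S a ^+ 2 - a ^+ 2], although 6 lies between them the other way round. *)
have := S_gt0 b; nra.
Qed.

(** This is [S_min] multiplied by [Psi x * Psi (- x)], using [S 0 * phi 0 = 1]. Both sides are even
    in [x]. *)
Lemma Psi_mul_PsiN x : Psi x * Psi (- x) <= phi x * phi 0.
Proof.
wlog x0 : x / 0 <= x.
  move=> H; have [/H//|/ltW x0] := leP 0 x.
  by have := H (- x); rewrite oppr_ge0 opprK phiN mulrC => /(_ x0).
have Sx y : S y * (Psi y * Psi (- y)) = phi y.
  rewrite /S /Y; have P0 := Psi_gt0 y; have P1 := Psi_gt0 (- y).
  transitivity (Phi y * Psi (- y) + Phi (- y) * Psi y).
    by field; rewrite !gt_eqF.
  by rewrite PsiN PhiN /Psi; ring.
have := S_min x0; rewrite -(ler_pM2r (mulr_gt0 (Psi_gt0 x) (Psi_gt0 (- x)))) Sx.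
have S0 : S 0 * phi 0 = 1.
  rewrite /S /Y oppr0 /Psi mul0r addr0 -mulrDl mulfVK ?phi_neq0//.
  by rewrite -[X in X + _]opprK -{1}oppr0 PhiN opprB; ring.
by rewrite -(ler_pM2r (phi_gt0 0)) mulrAC S0 mul1r.
Qed.

Lemma sqrt2_pi : 2 * phi 0 = Num.sqrt (2 / pi).
Proof.
rewrite phiE expr0n/= mul0r oppr0 expR0 mulr1 -[LHS]ger0_norm; last first.
  by rewrite divr_ge0// sqrtr_ge0.
rewrite -sqrtr_sqr; congr Num.sqrt; rewrite exprMn exprVn sqr_sqrtr.
  by rewrite expr2 invfM mulrA mulfK.
by rewrite mulr_ge0// pi_ge0.
Qed.

End gaussian.

(** * Mean values, Taylor remainders and integrals over half-lines *)

Section mean_value.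
Context {R : realType}.
Notation mu := (@lebesgue_measure R).
Implicit Types (f df ddf : R -> R) (x y : R).

Lemma is_derive_continuous f df : (forall x, is_derive x 1 f (df x)) -> continuous f.
Proof.
move=> fdf x; apply: differentiable_continuous; apply/derivable1_diffP.
by have [] := fdf x.
Qed.

(** The product inequality says that [c] lies between [x] and [y] whatever their order, which spares
    later case distinctions. *)
Lemma MVT_between f df x y : (forall x, is_derive x 1 f (df x)) ->
  exists2 c, f y - f x = df c * (y - x) & 0 <= (c - x) * (y - x) <= (y - x) ^+ 2.
Proof.
move=> fdf; have cf : continuous f := is_derive_continuous fdf.
have [xy|/ltW yx] := leP x y.
  have [c cxy fE] := MVT_segment xy (fun z _ => fdf z) (continuous_subspaceT cf).
  have xc : x <= c by rewrite (itvP cxy).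
  have cy : c <= y by rewrite (itvP cxy).
  by exists c => //; apply/andP; split; nra.
have [c cxy fE] := MVT_segment yx (fun z _ => fdf z) (continuous_subspaceT cf).
have xc : c <= x by rewrite (itvP cxy).
have cy : y <= c by rewrite (itvP cxy).
by exists c; [lra|apply/andP; split; nra].
Qed.

Lemma taylor2_le f df ddf (M : R) x y : 0 <= M ->
  (forall x, is_derive x 1 f (df x)) -> (forall x, is_derive x 1 df (ddf x)) ->
  (forall x, `|ddf x| <= M) ->
  `|f y - f x - df x * (y - x)| <= M / 2 * (y - x) ^+ 2.
Proof.
move=> M0 fdf dfddf ddfM.
(* With [s] equal to 1 or -1, [g s y <= 0] is one half of the absolute value bound. Two mean values
   write [g s y] as [s * ddf c' - M], which is at most 0, times a nonnegative product. *)
pose g (s : R) t := s * (f t - f x - df x * (t - x)) - M / 2 * (t - x) ^+ 2.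
pose dg (s : R) t := s * (df t - df x) - M * (t - x).
have gdg (s t : R) : is_derive t 1 (g s) (dg s t).
  have ? := fdf t; apply: is_derive_eq; rewrite /dg /GRing.scale/=; by field.
suff gle0 s : `|s| = 1 -> g s y <= 0.
  have := gle0 1 (normr1 _); have := gle0 (-1); rewrite normrN1 => /(_ erefl).
  by rewrite /g => g1 g2; rewrite ler_norml; apply/andP; split; lra.
move=> s1; have [c gc /andP[c0 c1]] := MVT_between x y (gdg s).
have gx : g s x = 0 by rewrite /g !subrr mulr0 subr0 expr0n/= !mulr0 subrr.
move: gc; rewrite gx subr0 => ->.
have [c' dfc _] := MVT_between x c dfddf.
rewrite /dg dfc (_ : _ * _ = (s * ddf c' - M) * ((c - x) * (y - x))); last by ring.
rewrite mulr_le0_ge0// subr_le0 (le_trans (ler_norm _))// normrM s1 mul1r.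
exact: ddfM.
Qed.

(** Dominated convergence for indicators of half-lines. Eventual membership leaves [D] free, so that
    the empty set and the whole line give the limits at the two ends. *)
Lemma cvg_Rintegral_itv f (u : R^nat) (D : set R) : measurable D ->
  mu.-integrable setT (EFin \o f) ->
  (forall x, \forall n \near \oo, (x <= u n) = (x \in D)) ->
  \int[mu]_(t in `]-oo, u n]) f t @[n --> \oo] --> \int[mu]_(t in D) f t.
Proof.
move=> mD intf uD.
have mf : measurable_fun setT f by apply/measurable_EFinP; exact: measurable_int intf.
have [] := @dominated_convergence _ _ _ mu setT measurableT
  (fun n => EFin \o (f \_ `]-oo, u n])) (EFin \o (f \_ D)) (abse \o (EFin \o f)).
- move=> n; apply/measurable_EFinP; apply: (measurable_restrictT _ _).1 => //.
  exact: measurable_funTS.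
- apply/measurable_EFinP; apply: (measurable_restrictT _ _).1 => //.
  exact: measurable_funTS.
- apply: aeW => x _; apply: cvg_EFin; first exact: nearW.
  apply: cvg_near_cst; near=> n; rewrite /= !patchE.
  have <- : (x <= u n) = (x \in D) by near: n.
  by rewrite mem_setE in_itv/=.
- exact: integrable_abse intf.
- apply: aeW => x n _ /=; rewrite lee_fin patchE.
  by case: ifP => _ //; rewrite normr0.
move=> ig _ icvg; rewrite -[X in _ --> X](fineK (integrable_fin_num measurableT ig)) in icvg.
move/fine_cvg : icvg => icvg.
rewrite [X in _ --> X]Rintegral_mkcond.
by under [X in X @ _]eq_fun do rewrite Rintegral_mkcond.
Unshelve. all: by end_near. Qed.

Lemma cvg_Rintegral_itvNy f : mu.-integrable setT (EFin \o f) ->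
  \int[mu]_(t in `]-oo, x]) f t @[x --> -oo] --> (0 : R).
Proof.
move=> intf; apply/cvg_ninftyP => u uNy.
have := @cvg_Rintegral_itv f u set0 measurable0 intf.
rewrite Rintegral_set0; apply => x; near=> n.
rewrite in_set0; apply/negbTE; rewrite -ltNge.
by near: n; exact: (cvgrNy_lt uNy).
Unshelve. all: by end_near. Qed.

Lemma cvg_Rintegral_itvy f : mu.-integrable setT (EFin \o f) ->
  \int[mu]_(t in `]-oo, x]) f t @[x --> +oo] --> \int[mu]_t f t.
Proof.
move=> intf; apply/cvg_pinftyP => u uNy.
apply: (@cvg_Rintegral_itv f u setT measurableT intf) => x; near=> n.
by rewrite mem_set//; near: n; exact: (cvgry_ge uNy).
Unshelve. all: by end_near. Qed.

End mean_value.

(** * Stein's equation for a differentiable 1-Lipschitz function *)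

Section stein_lipschitz.
Context {R : realType}.
Notation mu := (@lebesgue_measure R).
Variables h dh : R -> R.
Hypothesis hdh : forall x : R, is_derive x 1 h (dh x).
Hypothesis dh1 : forall x, `|dh x| <= 1.
Implicit Types x y : R.

Lemma lipschitz_growth x : `|h x| <= `|h 0| + `|x|.
Proof.
have [c hx _] := MVT_between 0 x hdh.
rewrite subr0 in hx.
rewrite -[h x](subrK (h 0)) hx addrC (le_trans (ler_normD _ _))// lerD2l.
by rewrite normrM ler_piMl.
Qed.

Lemma integrable_lipschitz_phi : mu.-integrable setT (EFin \o (fun t => h t * phi t)).
Proof.
(* The dominating function is a multiple of the density of variance 2: the factor
   [expR (- (t ^+ 2 / 4))] left over from [phi] absorbs the linear growth of [h]. *)
have ig : mu.-integrable setT (fun t => ((`|h 0| + 1) * Num.sqrt 2)%:E * (normal_pdf 0 (Num.sqrt 2) t)%:E)%E.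
  by apply: integrableZl => //; exact: integrable_normal_pdf.
apply: le_integrable ig => //.
  apply/measurable_EFinP; apply: continuous_measurable_fun => t.
  by apply: cvgM; [exact: is_derive_continuous hdh t|exact: continuous_phi].
move=> t _ /=; rewrite lee_fin normrM (ger0_norm (ltW (phi_gt0 t))).
have s20 : Num.sqrt 2 != 0 :> R by rewrite gt_eqF// sqrtr_gt0.
rewrite [leRHS]ger0_norm; last by rewrite mulr_ge0 ?normal_pdf_ge0// mulr_ge0 ?sqrtr_ge0// addr_ge0.
have -> : normal_pdf 0 (Num.sqrt 2) t =
    (Num.sqrt 2)^-1 * ((Num.sqrt (2 * pi))^-1 * expR (- (t ^+ 2 / 4))).
  rewrite (normal_pdfE _ s20) /normal_peak /normal_fun subr0 sqr_sqrtr//.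
  rewrite -mulr_natl sqrtrM// invfM -mulrA; congr (_ * (_ * expR _)).
  by field.
rewrite phiE -[leRHS]mulrA mulVKf// mulrCA [leRHS]mulrCA.
rewrite ler_wpM2l ?invr_ge0 ?sqrtr_ge0//.
have -> : - (t ^+ 2 / 2) = - (t ^+ 2 / 4) - t ^+ 2 / 4 by field.
rewrite expRD mulrCA [leRHS]mulrC ler_wpM2l ?expR_ge0//.
rewrite (le_trans (ler_wpM2r _ (lipschitz_growth t))) ?expR_ge0//.
rewrite expRN ler_pdivrMr ?expR_gt0//.
have := expR_ge1Dx (t ^+ 2 / 4); have := sqr_ge0 (`|t| - 2).
rewrite sqrrB real_normK ?num_real// => H0 H1.
have h00 := normr_ge0 (h 0); have t0 := normr_ge0 t.
have He : `|t| <= expR (t ^+ 2 / 4) by lra.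
have He1 : 1 <= expR (t ^+ 2 / 4) by rewrite -expR0 ler_expR divr_ge0// sqr_ge0.
by rewrite mulrDl mul1r lerD// ler_peMr.
Qed.

Definition stein_int x : R := \int[mu]_(t in `]-oo, x]) (h t * phi t).
Definition stein_mean : R := \int[mu]_t (h t * phi t).
Notation I := stein_int.
Notation C := stein_mean.

Let is_derive_I x : is_derive x 1 I (h x * phi x).
Proof.
have xx1 : x < x + 1 by rewrite ltrDl.
have chp : {for x, continuous (fun t => h t * phi t)}.
  by apply: cvgM; [exact: is_derive_continuous hdh x|exact: continuous_phi].
have ihp : mu.-integrable [set` `]-oo, (x + 1)]] (EFin \o (fun t => h t * phi t)).
  exact: integrableS integrable_lipschitz_phi.
have [dP eP] := continuous_FTC1 xx1 ihp (ltNyr _) chp.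
by apply: DeriveDef; [exact: dP|rewrite -derive1E; exact: eP].
Qed.

(** For [x <= 0], positivity of [Psi] says [|x| * Phi x < phi x], so linear growth is beaten by
    [Phi] at [-oo]. *)
Let cvg_h_PhiNy (k : R -> R) c : (forall x, `|k x| <= c + `|x|) ->
  k x * Phi x @[x --> -oo] --> (0 : R).
Proof.
move=> kc.
have cl : c * Phi x + phi x @[x --> -oo] --> (0 : R).
  rewrite -(addr0 0) -{1}(mulr0 c); apply: cvgD; last exact: cvg_phiNy.
  by apply: cvgM; [exact: cvg_cst|exact: cvg_PhiNy].
apply/cvgr0Pnorm_le => e e0.
have /cvgr0Pnorm_le/(_ e e0) := cl.
move=> ce; near=> x.
have x0 : x <= 0 by [].
have : `|c * Phi x + phi x| <= e by near: x.
apply: le_trans; rewrite normrM (ger0_norm (ltW (Phi_gt0 x))).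
rewrite (le_trans (ler_wpM2r _ (kc x))) ?(ltW (Phi_gt0 _))//.
rewrite (le_trans _ (ler_norm _))// mulrDl lerD2l ler0_norm//.
by have := Psi_gt0 x; rewrite /Psi; lra.
Unshelve. all: by end_near. Qed.

(** Both [Psi + g] and [Psi - g] vanish at [-oo] and have a nonnegative derivative, [Phi] times
    [1 + k] or [1 - k]. *)
Let norm_le_Psi g (k : R -> R) : (forall x, is_derive x 1 g (k x * Phi x)) ->
  (forall x, `|k x| <= 1) -> g x @[x --> -oo] --> (0 : R) ->
  forall x, `|g x| <= Psi x.
Proof.
move=> gk k1 g0 x.
have main (s : R) : `|s| = 1 -> 0 <= Psi x + s * g x.
  move=> s1.
  apply: (@is_derive_ge0_cvgNy _ (fun x => Psi x + s * g x)
    (fun x => Phi x + s * (k x * Phi x)) (x + 1)) => [y _|y _||].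
  - have ? := is_derive_Psi y; have ? := gk y.
    by apply: is_derive_eq.
  - rewrite mulrA -[X in X + _]mul1r -mulrDl mulr_ge0 ?(ltW (Phi_gt0 _))//.
    by have := ler_norm (- (s * k y)); rewrite normrN normrM s1 mul1r; have := k1 y; lra.
  - rewrite -(addr0 0); apply: cvgD; first exact: cvg_PsiNy.
    by rewrite -(mulr0 s); apply: cvgM => //; exact: cvg_cst.
  - by rewrite ltrDl.
have := main 1 (normr1 _); have := main (-1); rewrite normrN1 => /(_ erefl).
by move=> g1 g2; rewrite ler_norml; apply/andP; split; lra.
Qed.

(** [A] and [B] are, after integration by parts, the integrals of [dh * Phi] up to [x] and of
    [dh * (1 - Phi)] beyond [x]. The derivatives of the Stein solution are linear in them, up to the
    term [dh x] in the second one. *)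
Let A x := h x * Phi x - I x.
Let B x := C - I x - h x * (1 - Phi x).

Let norm_A x : `|A x| <= Psi x.
Proof.
apply: (@norm_le_Psi A dh) => // [y|].
  have ? := is_derive_Phi y; have ? := hdh y; have ? := is_derive_I y.
  by apply: is_derive_eq; rewrite /GRing.scale/=; ring.
rewrite -(subr0 0); apply: cvgB; last exact: cvg_Rintegral_itvNy integrable_lipschitz_phi.
apply: cvg_h_PhiNy; exact: lipschitz_growth.
Qed.

Let norm_B x : `|B x| <= Psi (- x).
Proof.
(* Reflection moves the decay at [+oo] to [-oo], where [norm_le_Psi] applies. *)
pose b y := C - I (- y) - h (- y) * Phi y.
have -> : B x = b (- x) by rewrite /B /b opprK PhiN.
apply: (@norm_le_Psi b (fun y => dh (- y))) => // [y|].
  have ? := is_derive_Phi y.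
  have ? : is_derive y 1 (h \o -%R) (dh (- y) * -1).
    by apply: is_derive1_comp; exact: hdh.
  have ? : is_derive y 1 (I \o -%R) (h (- y) * phi (- y) * -1).
    by apply: is_derive1_comp; exact: is_derive_I.
  have -> : b =
    (fun y => C - (I \o -%R) y - (h \o -%R) y * Phi y) by [].
  by apply: is_derive_eq; rewrite /GRing.scale/= phiN; ring.
rewrite -(subr0 0); apply: cvgB.
  rewrite -(subrr C); apply: cvgB; first exact: cvg_cst.
  by rewrite cvgNy_compNP/=; under eq_fun do rewrite opprK;
    exact: cvg_Rintegral_itvy integrable_lipschitz_phi.
apply: cvg_h_PhiNy => y; rewrite -(normrN y); exact: lipschitz_growth.
Qed.

Definition stein_sol x : R := (I x - C * Phi x) / phi x.
Notation f := stein_sol.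
Definition stein_dsol x : R := x * f x + h x - C.
Notation df := stein_dsol.
Let ddf x : R := f x + x * df x + dh x.

Lemma is_derive_stein_sol x : is_derive x 1 f (df x).
Proof.
have ? := is_derive_I x; have ? := is_derive_Phi x; have ? := is_derive_phi x.
have p0 := phi_neq0 x.
have ? : is_derive x 1 (fun y : R => (phi y)^-1) (- (phi x) ^- 2 *: (- x * phi x)).
  exact: is_deriveV.
have -> : f = (fun x => I x - C * Phi x) \* (fun y => (phi y)^-1) by [].
by apply: is_derive_eq; rewrite /df /f /GRing.scale/=; field.
Qed.

Let is_derive_dsol x : is_derive x 1 df (ddf x).
Proof.
have ? := is_derive_stein_sol x; have ? := hdh x.
by apply: is_derive_eq; rewrite /ddf /df /GRing.scale/=; ring.
Qed.

(** [df x * phi x] is [A x * Psi (- x) - B x * Psi x]. Each term is at most [Psi x * Psi (- x)],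
    hence at most [phi x * phi 0], and [2 * phi 0] is the constant. *)
Lemma stein_dsol_le x : `|df x| <= Num.sqrt (2 / pi).
Proof.
rewrite -sqrt2_pi.
have p0 := phi_gt0 x; have pn0 := phi_neq0 x.
rewrite -(ler_pM2r p0) -{1}(ger0_norm (ltW p0)) -normrM.
have -> : df x * phi x = A x * Psi (- x) - B x * Psi x.
  by rewrite /df /f PsiN /Psi /A /B; field.
rewrite (le_trans (ler_normB _ _))// !normrM.
rewrite !(ger0_norm (ltW (Psi_gt0 _))).
have := Psi_mul_PsiN x.
have := ler_wpM2r (ltW (Psi_gt0 (- x))) (norm_A x).
have := ler_wpM2r (ltW (Psi_gt0 x)) (norm_B x); lra.
Qed.

(** The weights [a] and [b] of [A] and [B] are nonnegative by [Phi_lower], and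
    [a * Psi x + b * Psi (- x)] is exactly [phi x]. This contributes 1, and [dh] contributes the
    other 1. *)
Let ddf_le x : `|ddf x| <= 2.
Proof.
have p0 := phi_gt0 x; have pn0 := phi_neq0 x.
rewrite -(ler_pM2r p0) -{1}(ger0_norm (ltW p0)) -normrM.
pose a := (1 + x ^+ 2) * (1 - Phi x) - x * phi x.
pose b := (1 + x ^+ 2) * Phi x + x * phi x.
have a0 : 0 <= a by have := Phi_lower (- x); rewrite phiN PhiN sqrrN /a; lra.
have b0 : 0 <= b by have := Phi_lower x; rewrite /b; lra.
have ab : a * Psi x + b * Psi (- x) = phi x by rewrite PsiN /a /b /Psi; ring.
have -> : ddf x * phi x = - (a * A x) - b * B x + dh x * phi x.
  by rewrite /ddf /df /f /A /B /a /b; field.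
rewrite (le_trans (ler_normD _ _))// (le_trans (lerD (ler_normB _ _) (lexx _)))//.
rewrite normrN !normrM (ger0_norm a0) (ger0_norm b0) (ger0_norm (ltW p0)).
have := ler_wpM2l a0 (norm_A x); have := ler_wpM2l b0 (norm_B x).
have := ler_wpM2r (ltW p0) (dh1 x); lra.
Qed.

Lemma stein_sol_taylor x y :
  `|f y - f x - df x * (y - x)| <= (y - x) ^+ 2.
Proof.
have := @taylor2_le _ f df ddf 2 x y _ is_derive_stein_sol is_derive_dsol ddf_le.
by rewrite divff// mul1r; apply.
Qed.

End stein_lipschitz.

(** * Expectations under the normal law as Lebesgue integrals *)

Section normal_expectation.
Context {R : realType}.
Notation mu := (@lebesgue_measure R).
Local Open Scope ereal_scope.

(** The Radon-Nikodym derivative of the normal law and [phi] have equal integrals over every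
    measurable set, so they agree almost everywhere. *)
Lemma ge0_integral_normal_prob (f : R -> \bar R) :
  measurable_fun setT f -> (forall x, 0 <= f x) ->
  \int[@normal_prob R 0 1]_x f x = \int[mu]_x (f x * (phi x)%:E).
Proof.
move=> mf f0; have dom := @normal_prob_dominates R 0 1.
rewrite -(Radon_Nikodym_SigmaFinite.change_of_variables dom f0 measurableT mf).
have mphi : measurable_fun setT (fun x : R => (phi x)%:E).
  by apply/measurable_EFinP; exact: measurable_normal_pdf.
have mRN := measurable_int _ (Radon_Nikodym_SigmaFinite.f_integrable dom).
apply: ge0_ae_eq_integral => //.
- exact: emeasurable_funM.
- exact: emeasurable_funM.
- by move=> x _; rewrite mule_ge0//; exact: Radon_Nikodym_SigmaFinite.f_ge0.
- by move=> x _; rewrite mule_ge0// lee_fin ltW// phi_gt0.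
apply: ae_eqe_mul2l; apply: integral_ae_eq => //.
- exact: Radon_Nikodym_SigmaFinite.f_integrable.
- by move=> A _ mA; rewrite -Radon_Nikodym_SigmaFinite.f_integral.
Qed.

Context d (T : measurableType d) (Q : probability T R) (Z : {RV Q >-> R}).
Hypothesis lawZ : forall A : set R, measurable A ->
  distribution Q Z A = normal_prob 0 1 A.

Let idTR : measurableTypeR R -> R := idfun.

#[local] HB.instance Definition _ :=
  @isMeasurableFun.Build _ _ _ _ idTR (@measurable_id _ _ setT).

Let ge0_integral_normal_RV (f : R -> \bar R) :
  measurable_fun setT f -> (forall x, 0 <= f x) ->
  \int[Q]_w f (Z w) = \int[mu]_x (f x * (phi x)%:E).
Proof.
move=> mf f0; rewrite -ge0_integral_normal_prob//.
rewrite -(ge0_integral_distribution Z mf f0).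
transitivity (\int[distribution (@normal_prob R 0 1) idTR]_y f y).
  by apply: eq_measure_integral => A mA _; exact: lawZ.
by rewrite ge0_integral_distribution.
Qed.

Lemma expectation_normal (h : R -> R) : measurable_fun setT h ->
  mu.-integrable setT (EFin \o (fun x => h x * phi x)%R) ->
  'E_Q[h \o Z] = (\int[mu]_x (h x * phi x))%:E.
Proof.
move=> mh ih; rewrite unlock /Rintegral fineK; last exact: integrable_fin_num.
have mEh : measurable_fun setT (EFin \o h) by exact/measurable_EFinP.
rewrite [LHS]integralE [RHS]integralE; congr (_ - _).
- transitivity (\int[Q]_w (EFin \o h)^\+ (Z w)).
    by apply: eq_integral => w _; rewrite ?funeposE ?funenegE.
  rewrite ge0_integral_normal_RV//; last exact: measurable_funepos.
  apply: eq_integral => x _; rewrite !funeposE /= -(@EFin_max R) -EFin_max -EFinM.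
  by rewrite maxr_pMl ?mul0r// ltW// phi_gt0.
- transitivity (\int[Q]_w (EFin \o h)^\- (Z w)).
    by apply: eq_integral => w _; rewrite ?funeposE ?funenegE.
  rewrite ge0_integral_normal_RV//; last exact: measurable_funeneg.
  apply: eq_integral => x _; rewrite !funenegE /= -(@EFin_max R) -EFin_max -EFinM.
  by rewrite maxr_pMl ?mul0r ?mulNr// ltW// phi_gt0.
Qed.

Lemma probability_normal (z : R) : Q [set w | (Z w <= z)%R] = (Phi z)%:E.
Proof.
by rewrite Phi_normal_prob -lawZ.
Qed.

End normal_expectation.

Section smoothing.
Context {R : realType}.
Notation mu := (@lebesgue_measure R).
Implicit Types x y : R.

(** [he x] is the average of [h] over [[x, x + e]]; its derivative is a difference quotient of
    [h]. *)
Lemma exists_smoothing (h : R -> R) (e : R) : 0 < e ->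
  (forall x y, `|h x - h y| <= `|x - y|) ->
  exists he dhe : R -> R, [/\ forall x, is_derive x 1 he (dhe x),
    forall x, `|dhe x| <= 1 & forall x, `|he x - h x| <= e].
Proof.
move=> e0 hlip.
have ch : continuous h.
  move=> x; apply/cvgrPdist_le => /= r r0; near=> y.
  by rewrite (le_trans (hlip _ _)).
pose H a y := \int[mu]_(t in `[a, y]) h t.
have dH a y : a < y -> is_derive y 1 (H a) (h y).
  move=> ay; have yy1 : y < y + 1 by rewrite ltrDl.
  have ih : mu.-integrable [set` `[a, (y + 1)]] (EFin \o h).
    apply: continuous_compact_integrable => //; first exact: segment_compact.
    exact: continuous_subspaceT.
  have [dP eP] := continuous_FTC1_closed yy1 ih ay (ch y).
  by apply: DeriveDef; [exact: dP|rewrite -derive1E; exact: eP].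
have Hab a b x y : a < x -> b < x -> x <= y -> H a y - H a x = H b y - H b x.
  move=> ax bx xy.
  have dHab t : x <= t -> is_derive (t : R) 1 (fun y => H a y - H b y) 0.
    move=> xt; have ? := dH a t (lt_le_trans ax xt).
    have ? := dH b t (lt_le_trans bx xt).
    by apply: is_derive_eq; rewrite subrr.
  have [| |c _] := @MVT_segment R (fun y => H a y - H b y) (fun=> 0) x y xy.
  - by move=> t; rewrite in_itv/= => /andP[/ltW xt _]; exact: dHab.
  - apply: derivable_within_continuous => t; rewrite in_itv/= => /andP[xt _].
    by have [] := dHab _ xt.
  by rewrite mul0r => ?; lra.
(* The primitive needs a finite base point to the left of [x], hence one moving with [x]. By [Hab]
   the increment does not depend on it, so it can be frozen near each point. *)
pose he x := (H (x - 1) (x + e) - H (x - 1) x) / e.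
exists he, (fun x => (h (x + e) - h x) / e); split.
- move=> x.
  apply: (@near_eq_is_derive _ _ _ (fun y => (H (x - 1) (y + e) - H (x - 1) y) / e)).
  + near=> y; rewrite /he; congr (_ / e); apply: Hab; rewrite ?gtrBl ?lerDl ?ltW//.
    by near: y; apply: lt_nbhsr; rewrite gtrBl.
  + have xx : x - 1 < x by rewrite gtrBl.
    have ? := dH (x - 1) x xx.
    have ? : is_derive x 1 (H (x - 1) \o (fun y => y + e)) (h (x + e) * 1).
      apply: is_derive1_comp; first by apply: dH; rewrite (lt_le_trans xx)// lerDl ltW.
      by apply: is_derive_eq; rewrite addr0.
    have -> : (fun y => (H (x - 1) (y + e) - H (x - 1) y) / e) =
      (fun y => ((H (x - 1) \o (fun y => y + e)) y - H (x - 1) y) * e^-1) by [].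
    by apply: is_derive_eq; rewrite /GRing.scale/=; ring.
- move=> x; rewrite normrM normfV (ger0_norm (ltW e0)) ler_pdivrMr// mul1r.
  by rewrite (le_trans (hlip _ _))// addrAC subrr add0r ger0_norm// ltW.
move=> x; rewrite /he.
have [| | |c cxe ->] := @MVT R (H (x - 1)) h x (x + e).
- by rewrite ltrDl.
- by move=> z; rewrite in_itv/= => /andP[xz _]; apply: dH; rewrite (lt_trans _ xz)// gtrBl.
- apply: derivable_within_continuous => z; rewrite in_itv/= => /andP[xz _].
  by have [] := dH (x - 1) z _; rewrite // (lt_le_trans _ xz)// gtrBl.
have xc : x < c by rewrite (itvP cxe).
have cx : c < x + e by rewrite (itvP cxe).
rewrite [x + e]addrC addrK mulfK ?gt_eqF//.
by rewrite (le_trans (hlip _ _))// ger0_norm; lra.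
Unshelve. all: by end_near. Qed.

End smoothing.

(** * Stein's equation for the indicator of a half-line *)

Section stein_indicator.
Context {R : realType}.
Variable z : R.
Implicit Types x y : R.

Let p x : R := Phi x / phi x.

Let is_derive_p x : is_derive x 1 p (1 + x * p x).
Proof.
have ? := is_derive_Phi x; have ? := is_derive_phi x; have p0 := phi_neq0 x.
have ? : is_derive x 1 (fun y : R => (phi y)^-1) (- (phi x) ^- 2 *: (- x * phi x)).
  exact: is_deriveV.
have -> : p = Phi \* (fun y => (phi y)^-1) by [].
by apply: is_derive_eq; rewrite /p /GRing.scale/=; field.
Qed.

Let dp_gt0 x : 0 < 1 + x * p x.
Proof.
have -> : 1 + x * p x = Psi x / phi x.
  by rewrite /p /Psi; field; exact: phi_neq0.
by rewrite divr_gt0 ?Psi_gt0 ?phi_gt0.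
Qed.

Let xp x := x * p x.

Let xp_nd x y : x <= y -> xp x <= xp y.
Proof.
have dxp (t : R) : is_derive t 1 xp (p t + t * (1 + t * p t)).
  by have ? := is_derive_p t; apply: is_derive_eq; rewrite /GRing.scale/=; ring.
move=> xy; apply: (is_derive_nondecreasing (fun t _ => dxp t) _ (b := y + 1)) => //.
  move=> t _; have -> : p t + t * (1 + t * p t) = ((1 + t ^+ 2) * Phi t + t * phi t) / phi t.
    by rewrite /p; field; exact: phi_neq0.
  by rewrite divr_ge0 ?(ltW (phi_gt0 _))//; have := Phi_lower t; lra.
by rewrite ltrDl.
Qed.

(** The bounded solution in closed form; the two branches agree at [z]. *)
Definition stein_ind x : R :=
  if x <= z then p x * (1 - Phi z) else p (- x) * Phi z.
Notation f := stein_ind.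
Let u x := x * f x.

Let fl x : x <= z -> f x = p x * (1 - Phi z).
Proof. by rewrite /f => ->. Qed.

Let fr x : z <= x -> f x = p (- x) * Phi z.
Proof.
rewrite le_eqVlt => /predU1P[<-|]; last by rewrite /f ltNge; case: ifP.
by rewrite fl// /p phiN PhiN; ring.
Qed.

Let Phi01 : 0 < Phi z < 1. Proof. by rewrite Phi_gt0 Phi_lt1. Qed.

(** On either side of [z], [u] is a nonnegative multiple of [xp x] or of [- xp (- x)], both
    nondecreasing by [xp_nd]; the pieces are glued at [z]. *)
Let u_nd x y : x <= y -> u x <= u y.
Proof.
have /andP[P0 P1] := Phi01.
have nl s t : s <= t -> t <= z -> u s <= u t.
  move=> st tz; rewrite /u !fl//; last exact: le_trans tz.
  by rewrite [leLHS]mulrA [leRHS]mulrA; apply: ler_wpM2r; [rewrite subr_ge0 ltW|exact: xp_nd].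
have nr s t : z <= s -> s <= t -> u s <= u t.
  move=> zs st; rewrite /u !fr//; last exact: le_trans st.
  rewrite [leLHS]mulrA [leRHS]mulrA ler_wpM2r ?(ltW P0)//.
  by have := @xp_nd (- t) (- s); rewrite lerN2 /xp !mulNr lerN2; apply.
move=> xy; have [yz|/ltW zy] := leP y z; first exact: nl.
have [xz|/ltW zx] := leP x z; last exact: nr.
by rewrite (le_trans (nl _ _ xz _))//; exact: nr.
Qed.

(** [dp_gt0] means [x * p x > -1], which gives the lower bound left of [z] and the upper bound right
    of it; monotonicity of [u] supplies the other two. *)
Let u_bound x : - (1 - Phi z) <= u x <= Phi z.
Proof.
have /andP[P0 P1] := Phi01.
have lo t : t <= z -> - (1 - Phi z) <= u t.
  by move=> tz; rewrite /u fl// mulrA; have := dp_gt0 t; nra.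
have hi t : z <= t -> u t <= Phi z.
  by move=> tz; rewrite /u fr// mulrA; have := dp_gt0 (- t); nra.
have [xz|/ltW zx] := leP x z; apply/andP; split.
- exact: lo.
- by rewrite (le_trans (u_nd xz))// hi.
- by rewrite (le_trans _ (u_nd zx))// lo.
- exact: hi.
Qed.

(** Away from [z] the slope of [f] is [u - Phi z] plus the indicator. Along [[x, y]] the first part
    rises and the second drops, so each bound takes them at opposite ends. *)
Let f_between x y : x <= y ->
  (u x - Phi z + ((y <= z)%R)%:R) * (y - x) <= f y - f x <=
  (u y - Phi z + ((x <= z)%R)%:R) * (y - x).
Proof.
have /andP[P0 P1] := Phi01.
have ml s t : s <= t -> t <= z ->
    (u s + 1 - Phi z) * (t - s) <= f t - f s <= (u t + 1 - Phi z) * (t - s).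
  move=> st tz; rewrite !fl//; last exact: le_trans tz.
  have [|c cst pE] := MVT_segment st (fun y _ => is_derive_p y).
    exact/continuous_subspaceT/is_derive_continuous/is_derive_p.
  have sc : s <= c by rewrite (itvP cst).
  have ct : c <= t by rewrite (itvP cst).
  have -> : p t * (1 - Phi z) - p s * (1 - Phi z) = (u c + 1 - Phi z) * (t - s).
    by rewrite -mulrBl pE /u fl ?(le_trans ct)//; ring.
  by rewrite !ler_wpM2r ?subr_ge0// !lerD2r u_nd.
have mr s t : z <= s -> s <= t ->
    (u s - Phi z) * (t - s) <= f t - f s <= (u t - Phi z) * (t - s).
  move=> zs st; rewrite !fr//; last exact: le_trans st.
  have st' : - t <= - s by rewrite lerN2.
  have [|c cst pE] := MVT_segment st' (fun y _ => is_derive_p y).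
    exact/continuous_subspaceT/is_derive_continuous/is_derive_p.
  have ct : c <= - s by rewrite (itvP cst).
  have sc : - t <= c by rewrite (itvP cst).
  have -> : p (- t) * Phi z - p (- s) * Phi z = (u (- c) - Phi z) * (t - s).
    by rewrite -mulrBl -opprB pE /u fr ?opprK; [ring|lra].
  by rewrite !ler_wpM2r ?subr_ge0// !lerD2r !u_nd//; lra.
move=> xy; have [yz|/ltW zy] := leP y z.
  have xz : x <= z by exact: le_trans yz.
  by rewrite xz /= addrAC [_ - _ + _]addrAC; exact: ml.
have [xz|/ltW zx] := leP x z; last by rewrite !addr0; exact: mr.
have /andP[l1 l2] := ml _ _ xz (lexx z).
have /andP[r1 r2] := mr _ _ (lexx z) zy.
have uxz := u_nd xz; have uzy := u_nd zy.
have -> : f y - f x = (f y - f z) + (f z - f x) by ring.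
rewrite addr0 /=; apply/andP; split; nra.
Qed.

Lemma stein_ind_lipschitz x y : `|f x - f y| <= `|x - y|.
Proof.
have /andP[P0 P1] := Phi01.
wlog xy : x y / x <= y.
  by move=> H; have [/H//|/ltW /H] := leP x y; rewrite distrC [leRHS]distrC.
have /andP[l r] := f_between xy.
have /andP[ux _] := u_bound x; have /andP[_ uy] := u_bound y.
rewrite distrC [leRHS]distrC (ger0_norm (_ : 0 <= y - x)) ?subr_ge0// ler_norml.
have b1 : ((y <= z)%R)%:R >= 0 :> R by rewrite ler0n.
have b2 : ((x <= z)%R)%:R <= 1 :> R by rewrite lern1 leq_b1.
by apply/andP; split; nra.
Qed.

Definition stein_dind x : R := x * f x + ((x <= z)%R)%:R - Phi z.
Definition stein_gind x : R := x * f x - ((x <= z)%R)%:R.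
Notation df := stein_dind.
Notation g := stein_gind.

Lemma stein_dind_le1 x : `|df x| <= 1.
Proof.
have /andP[P0 P1] := Phi01; have /andP[l r] := u_bound x.
rewrite /df -/(u x) ler_norml; have [xz|zx] := leP x z; rewrite /= ?mulr0n ?mulr1n; last first.
  by apply/andP; split; lra.
have := u_bound x.
have : 0 <= u x + 1 - Phi z.
  by rewrite /u fl// mulrA; have := dp_gt0 x; nra.
by move=> ? /andP[? ?]; apply/andP; split; lra.
Qed.

Lemma stein_gind_le2 x : `|g x| <= 2.
Proof.
have /andP[P0 P1] := Phi01; have /andP[l r] := u_bound x.
have b1 : ((x <= z)%R)%:R >= 0 :> R by rewrite ler0n.
have b2 : ((x <= z)%R)%:R <= 1 :> R by rewrite lern1 leq_b1.
by rewrite /g -/(u x) ler_norml; apply/andP; split; lra.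
Qed.

(** [u] and the indicator each oscillate by at most 1. This is the factor 2 of the second Kolmogorov
    term; [stein_gind_le2] would only give 4 here, and supplies the factor of the third. *)
Lemma stein_gind_osc x y : `|g x - g y| <= 2.
Proof.
have /andP[P0 P1] := Phi01; have /andP[l r] := u_bound x.
have /andP[l' r'] := u_bound y.
have b1 t : ((t <= z)%R)%:R >= 0 :> R by rewrite ler0n.
have b2 t : ((t <= z)%R)%:R <= 1 :> R by rewrite lern1 leq_b1.
have := b1 x; have := b2 x; have := b1 y; have := b2 y.
by rewrite /g -/(u x) -/(u y) ler_norml => ? ? ? ?; apply/andP; split; lra.
Qed.

(** Subtracting [df x] from the slopes in [f_between] leaves either an increment of [u] or a drop of
    the indicator. Both are parts of the increment of [g], which has the sign of [y - x]. *)
Lemma stein_ind_taylor x y :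
  `|f y - f x - df x * (y - x)| <= (y - x) * (g y - g x).
Proof.
have b (s t : R) : s <= t -> ((t <= z)%R)%:R <= ((s <= z)%R)%:R :> R.
  move=> st; rewrite ler_nat; case: (leP t z) => // tz.
  by rewrite (le_trans st tz).
have [xy|/ltW yx] := leP x y.
  have /andP[l r] := f_between xy; have ub := u_nd xy; have bb := b _ _ xy.
  by rewrite /df /g -/(u x) -/(u y) ler_norml; apply/andP; split; nra.
have /andP[l r] := f_between yx; have ub := u_nd yx; have bb := b _ _ yx.
by rewrite /df /g -/(u x) -/(u y) ler_norml; apply/andP; split; nra.
Qed.

End stein_indicator.

Local Open Scope ereal_scope.

(** * Conditional expectations and orthogonality *)

Section sub_sigma_algebra.
Context d (T : measurableType d) (R : realType) (P : probability T R).
Variable G : set (set T).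
Hypothesis GT : G `<=` measurable.
Notation N := (g_sigma_algebraType G).

Lemma sub_sigma_measurable : <<s G >> `<=` (measurable : set (set T)).
Proof. by apply: smallest_sub => //; exact: sigma_algebra_measurable. Qed.

Lemma sub_sigma_measurable_fun (Z : T -> R) :
  measurable_fun [set: N] (Z : N -> R) -> measurable_fun [set: T] Z.
Proof. by move=> mZ _ B mB; apply: sub_sigma_measurable; exact: mZ. Qed.

(** The distribution of this identity is the restriction of [P] to the generated sigma-algebra. *)
Let idG : T -> N := idfun.

Let measurable_idG : measurable_fun [set: T] idG.
Proof. by move=> _ B mB; rewrite setTI; exact: sub_sigma_measurable. Qed.

#[local] HB.instance Definition _ :=
  @isMeasurableFun.Build _ _ _ _ idG measurable_idG.

Section existence.
Variable Y : T -> R.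
Hypothesis iY : P.-integrable [set: T] (EFin \o Y).

Definition restricted_charge (A : set N) : \bar R := \int[P]_(w in A) (Y w)%:E.
Let nu := restricted_charge.

Let nu0 : nu set0 = 0.
Proof. by rewrite /nu /restricted_charge integral_set0. Qed.

Let finnu A : measurable A -> nu A \is a fin_num.
Proof.
move=> /sub_sigma_measurable mA; apply: integrable_fin_num => //.
exact: integrableS iY.
Qed.

Let snu : semi_sigma_additive nu.
Proof.
move=> A mA tA mUA.
have H := @charge_semi_sigma_additive _ _ _ (induced_charge iY).
exact: (H A (fun i => sub_sigma_measurable (mA i)) tA (sub_sigma_measurable mUA)).
Qed.

HB.instance Definition _ := isCharge.Build _ _ _ nu nu0 finnu snu.

Let nu_dominated : nu `<< distribution P idG.
Proof.
apply/null_content_dominatesP => A mA PA0.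
have mA' := sub_sigma_measurable mA; have PA : P A = 0 := PA0.
apply: null_set_integral => //; apply: measurable_funTS; exact: measurable_int iY.
Qed.

(** The version is the Radon-Nikodym derivative of [nu] with respect to the restricted probability;
    it is finite everywhere, so [fine] loses nothing. *)
Lemma exists_is_condE : exists Z, is_condE P G Y Z.
Proof.
pose f := Radon_Nikodym nu (distribution P idG).
have fE : EFin \o (fine \o f) = f.
  by apply/funext => w /=; rewrite fineK//; exact: Radon_Nikodym_fin_num nu_dominated.
have fi : (distribution P idG).-integrable setT f by exact: Radon_Nikodym_integrable nu_dominated.
have mf : measurable_fun [set: N] f by exact: measurable_int fi.
have fiT : P.-integrable setT f.
  apply/integrableP; split.
    by move=> _ B mB; apply: sub_sigma_measurable; exact: mf.
  have /integrableP[_] := fi.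
  by rewrite ge0_integral_distribution//; exact: measurableT_comp.
exists (fine \o f); split.
- by apply/measurable_EFinP; rewrite fE.
- by apply/Lfun1_integrable; rewrite fE.
- move=> A sA; transitivity (\int[P]_(w in A) f w).
    by apply: eq_integral => w _; rewrite -[in RHS]fE.
  transitivity (\int[distribution P idG]_(w in A) f w); last first.
    by rewrite -Radon_Nikodym_integral//; exact: nu_dominated.
  rewrite integral_pushforward// preimage_id.
  by apply: (integrableS measurableT) => //; exact: sub_sigma_measurable.
Qed.

Lemma condEP : is_condE P G Y (condE P G Y).
Proof. exact: xgetPex exists_is_condE. Qed.

End existence.

Section orthogonality.
Import HBNNSimple.
Variable D : T -> R.
Hypothesis iD : P.-integrable [set: T] (EFin \o D).
Hypothesis D0 : forall A, <<s G >> A -> \int[P]_(w in A) (D w)%:E = 0.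

Let integral_mul_nnsfun_eq0 (h : {nnsfun N >-> R}) :
  \int[P]_w (D w * h w)%:E = 0.
Proof.
have mA r : <<s G >> (h @^-1` [set r]).
  rewrite -[X in <<s G >> X]setTI; exact: (@measurable_funPT _ _ _ _ h measurableT [set r]).
have iDA A : <<s G >> A -> P.-integrable [set: T] (fun w => (D w * \1_A w)%:E).
  move=> sA; apply: le_integrable iD => //.
    apply/measurable_EFinP; apply: measurable_funM.
      by apply/measurable_EFinP; exact: measurable_int iD.
    by apply: measurable_indic; exact: sub_sigma_measurable.
  move=> w _; rewrite /= lee_fin normrM ler_piMr// indicE.
  by case: (_ \in _); rewrite ?normr1 ?normr0.
have D1 A : <<s G >> A -> \int[P]_w (D w * \1_A w)%:E = 0.
  move=> sA; rewrite -[RHS](D0 sA) [RHS]integral_mkcond; apply: eq_integral => w _.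
  by rewrite patchE indicE; case: (_ \in _); rewrite ?mulr1 ?mulr0.
transitivity (\int[P]_w (\sum_(r <- fset_set (range h))
    (r%:E * (D w * \1_(h @^-1` [set r]) w)%:E))).
  apply: eq_integral => w _; rewrite {1}fimfunE fsbig_finite//= mulr_sumr -sumEFin.
  by apply: eq_bigr => r _; rewrite -EFinM mulrCA.
rewrite integral_sum//; last by move=> r; apply: integrableZl => //; exact: iDA.
rewrite big1// => r _; rewrite integralZl//; last exact: iDA.
by rewrite D1// mule0.
Qed.

Let integral_mul_ge0_eq0 (W : N -> R) : measurable_fun [set: N] W ->
  (forall w, 0 <= W w)%R -> P.-integrable [set: T] (fun w => (D w * W w)%:E) ->
  \int[P]_w (D w * W w)%:E = 0.
Proof.
move=> mW W0 iDW.
have mEW : measurable_fun [set: N] (EFin \o W) by exact/measurable_EFinP.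
have mD : measurable_fun [set: T] D by apply/measurable_EFinP; exact: measurable_int iD.
pose h n : {nnsfun N >-> R} := nnsfun_approx measurableT mEW n.
have hW n w : (h n w <= W w)%R.
  rewrite -lee_fin /h nnsfun_approxE.
  by apply: (@le_approx _ _ _ setT (EFin \o W)) => // v _; rewrite lee_fin.
have hW' w : (h ^~ w) n @[n --> \oo] --> W w.
  by have /fine_cvgP[_] := @cvg_nnsfun_approx _ _ _ _ measurableT _ mEW
    (fun v _ => W0 v) w Logic.I.
have mh m : measurable_fun [set: T] (h m).
  by apply: (@sub_sigma_measurable_fun (h m)); exact: measurable_funPT.
have [|||||] := @dominated_convergence _ _ _ P setT measurableT
    (fun n w => (D w * h n w)%:E) (fun w => (D w * W w)%:E)
    (abse \o (fun w => (D w * W w)%:E)).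
- by move=> n; apply/measurable_EFinP; exact: measurable_funM.
- by apply: measurable_int iDW.
- apply: aeW => w _; apply: cvg_EFin; first exact: nearW.
  by apply: cvgM; [exact: cvg_cst|exact: hW'].
- exact: integrable_abse.
- apply: aeW => w n _ /=; rewrite lee_fin !normrM ler_wpM2l//.
  by rewrite !ger0_norm.
move=> _ _ Dh; apply: (cvg_unique _ Dh) => //.
by apply: cvg_near_cst; apply: nearW => n; exact: integral_mul_nnsfun_eq0.
Qed.

(** From indicators to simple functions, to nonnegative [W] by dominated convergence under
    [|D * W|], then to both parts of [W]. Integrability is asked of the product only, so [W] may be
    unbounded. *)
Lemma integral_mul_eq0 (W : T -> R) : measurable_fun [set: N] (W : N -> R) ->
  P.-integrable [set: T] (fun w => (D w * W w)%:E) ->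
  \int[P]_w (D w * W w)%:E = 0.
Proof.
move=> mW iDW; have mWT := sub_sigma_measurable_fun mW.
have iW (V : T -> R) : measurable_fun [set: N] (V : N -> R) ->
    (forall w, `|V w| <= `|W w|)%R ->
    P.-integrable [set: T] (fun w => (D w * V w)%:E).
  move=> mV VW; apply: le_integrable iDW => //.
    apply/measurable_EFinP; apply: measurable_funM; last exact: sub_sigma_measurable_fun.
    by apply/measurable_EFinP; exact: measurable_int iD.
  by move=> w _; rewrite /= lee_fin !normrM ler_wpM2l.
have mWp : measurable_fun [set: N] (W^\+ : N -> R)%R by exact: measurable_funrpos.
have mWn : measurable_fun [set: N] (W^\- : N -> R)%R by exact: measurable_funrneg.
have iWp : P.-integrable [set: T] (fun w => (D w * W^\+%R w)%:E).
  apply: iW mWp _ => w; rewrite [leLHS]ger0_norm// /funrpos ge_max normr_ge0 andbT.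
  exact: ler_norm.
have iWn : P.-integrable [set: T] (fun w => (D w * W^\-%R w)%:E).
  apply: iW mWn _ => w; rewrite [leLHS]ger0_norm// /funrneg ge_max normr_ge0 andbT.
  by rewrite -normrN ler_norm.
transitivity (\int[P]_w ((D w * W^\+%R w)%:E - (D w * W^\-%R w)%:E)).
  by apply: eq_integral => w _; rewrite -EFinB -mulrBr /funrpos /funrneg /=; congr (_ * _)%:E;
    case: (leP (W w) 0%R) => ?; case: (leP (- W w)%R 0%R) => ?; lra.
rewrite integralB// !integral_mul_ge0_eq0 ?subee//.
Qed.
End orthogonality.
End sub_sigma_algebra.

(** * Square-integrable functions and orthogonal projections *)

Section L2.
Context d (T : measurableType d) (R : realType) (P : probability T R).
Implicit Types X Y Z V W : T -> R.
Notation L2 := (Lfun P 2%:E).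

Lemma L2_measurable X : X \in L2 -> measurable_fun [set: T] X.
Proof. by rewrite inE => /andP[]; rewrite inE. Qed.

Lemma L2P X : measurable_fun [set: T] X ->
  X \in L2 <-> \int[P]_w (X w ^+ 2)%:E < +oo.
Proof.
move=> mX; split=> [/Lfun2_integrable_sqr /integrableP[_]|].
  by under eq_integral do rewrite /= ger0_norm ?sqr_ge0//.
move=> X2; rewrite inE; apply/andP; split; rewrite inE//=.
rewrite /finite_norm unlock poweR_lty//.
by under eq_integral do rewrite /= powR_mulrn// real_normK ?num_real//.
Qed.

Lemma L2_le X Y : measurable_fun [set: T] X -> Y \in L2 ->
  (forall w, `|X w| <= `|Y w|)%R -> X \in L2.
Proof.
move=> mX Y2 XY; apply/L2P => //.
have := (L2P (L2_measurable Y2)).1 Y2; apply: le_lt_trans.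
apply: ge0_le_integral => //.
- by move=> w _; rewrite lee_fin sqr_ge0.
- by apply/measurable_EFinP; exact: measurable_funX.
- by apply/measurable_EFinP/measurable_funX; exact: L2_measurable.
- by move=> w _; rewrite lee_fin -[leLHS]real_normK ?num_real// -[leRHS]real_normK ?num_real// lerXn2r ?nnegrE.
Qed.

Lemma L2_normr X : X \in L2 -> (fun w => `|X w|%R) \in L2.
Proof.
move=> X2; apply: (L2_le _ X2) => [|w]; last by rewrite normr_id.
exact: measurableT_comp (L2_measurable X2).
Qed.

Lemma L2_cst c : (cst c : T -> R) \in L2.
Proof. exact: Lfun_cst. Qed.

Lemma L2B X Y : X \in L2 -> Y \in L2 -> (X \- Y)%R \in L2.
Proof. by move=> X2 Y2; apply: rpredB => //; rewrite lee1n. Qed.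

Lemma L2N X : X \in L2 -> (\- X)%R \in L2.
Proof. exact: Lfun_oppr_closed. Qed.

Lemma L2D X Y : X \in L2 -> Y \in L2 -> (X \+ Y)%R \in L2.
Proof. by move=> X2 Y2; apply: rpredD => //; rewrite lee1n. Qed.

Lemma L2_integrable X : X \in L2 -> P.-integrable [set: T] (EFin \o X).
Proof.
by move=> X2; apply/Lfun1_integrable/Lfun_subset12 => //; exact: fin_num_measure.
Qed.

Lemma L2_mul_integrable X Y : X \in L2 -> Y \in L2 ->
  P.-integrable [set: T] (fun w => (X w * Y w)%:E).
Proof. by move=> X2 Y2; apply/Lfun1_integrable; exact: Lfun2_mul_Lfun1. Qed.

(** Only semidefinite, since functions are not identified modulo null sets: almost sure equality of
    [X] and [Y] is expressed by a vanishing square of [X - Y]. *)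
Definition ip X Y : R := (\int[P]_w (X w * Y w))%R.

Lemma ipE X Y : X \in L2 -> Y \in L2 -> 'E_P[fun w => (X w * Y w)%R] = (ip X Y)%:E.
Proof.
move=> X2 Y2; rewrite unlock /ip /Rintegral fineK//.
exact/integrable_fin_num/L2_mul_integrable.
Qed.

Lemma ip_sqrE X : X \in L2 -> 'E_P[fun w => (X w ^+ 2)%R] = (ip X X)%:E.
Proof. by move=> X2; rewrite -ipE. Qed.

Lemma ipC X Y : ip X Y = ip Y X.
Proof. by rewrite /ip; under eq_Rintegral do rewrite mulrC. Qed.

Lemma ip_ge0 X : (0 <= ip X X)%R.
Proof. by apply: Rintegral_ge0 => w _; rewrite -expr2 sqr_ge0. Qed.

Lemma ipDl X Y Z : X \in L2 -> Y \in L2 -> Z \in L2 ->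
  ip (X \+ Y)%R Z = (ip X Z + ip Y Z)%R.
Proof.
move=> X2 Y2 Z2; rewrite /ip -RintegralD//; last 2 first.
- exact: L2_mul_integrable.
- exact: L2_mul_integrable.
by apply: eq_Rintegral => w _ /=; rewrite mulrDl.
Qed.

Lemma ipBl X Y Z : X \in L2 -> Y \in L2 -> Z \in L2 ->
  ip (X \- Y)%R Z = (ip X Z - ip Y Z)%R.
Proof.
move=> X2 Y2 Z2; rewrite /ip -RintegralB//; last 2 first.
- exact: L2_mul_integrable.
- exact: L2_mul_integrable.
by apply: eq_Rintegral => w _ /=; rewrite mulrBl.
Qed.

Lemma ipBr X Y Z : X \in L2 -> Y \in L2 -> Z \in L2 ->
  ip X (Y \- Z)%R = (ip X Y - ip X Z)%R.
Proof. by move=> X2 Y2 Z2; rewrite ipC ipBl// !(ipC X). Qed.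

Lemma ipDr X Y Z : X \in L2 -> Y \in L2 -> Z \in L2 ->
  ip X (Y \+ Z)%R = (ip X Y + ip X Z)%R.
Proof. by move=> X2 Y2 Z2; rewrite ipC ipDl// !(ipC X). Qed.

Lemma ip_le X Y : X \in L2 -> Y \in L2 -> (forall w, `|X w| <= `|Y w|)%R ->
  (ip X X <= ip Y Y)%R.
Proof.
move=> X2 Y2 XY; apply: le_Rintegral => //.
- exact: L2_mul_integrable.
- exact: L2_mul_integrable.
by move=> w _; rewrite -!expr2 -[leLHS]real_normK ?num_real// -[leRHS]real_normK ?num_real// lerXn2r ?nnegrE.
Qed.

Lemma ip_sub_sqr X Y : X \in L2 -> Y \in L2 ->
  ip (X \- Y)%R (X \- Y)%R = (ip X X - 2 * ip X Y + ip Y Y)%R.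
Proof.
move=> X2 Y2; have XY2 := L2B X2 Y2.
by rewrite ipBl// !ipBr// (ipC Y X); ring.
Qed.

Lemma ip_add_sqr X Y : X \in L2 -> Y \in L2 ->
  ip (X \+ Y)%R (X \+ Y)%R = (ip X X + 2 * ip X Y + ip Y Y)%R.
Proof.
move=> X2 Y2; have XY2 := L2D X2 Y2.
by rewrite ipDl// !ipDr// (ipC Y X); ring.
Qed.

Lemma ip_sub_le X Y : X \in L2 -> Y \in L2 ->
  (ip (X \- Y)%R (X \- Y)%R <= 2 * ip X X + 2 * ip Y Y)%R.
Proof.
move=> X2 Y2; rewrite ip_sub_sqr//.
by have := ip_ge0 (X \+ Y)%R; rewrite ip_add_sqr//; lra.
Qed.

(** The degenerate case of Cauchy-Schwarz: expanding the squares of [t X + Z] and [t X - Z] bounds a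
    linear term in [t] by a quadratic one, which fails for small [t] unless the product is 0. *)
Lemma ip_eq0 X Z : X \in L2 -> Z \in L2 -> ip Z Z = 0%R -> ip X Z = 0%R.
Proof.
move=> X2 Z2 ZZ.
have h (t : R) : (0 <= t -> 2 * t * `|ip X Z| <= t ^+ 2 * ip X X)%R.
  move=> t0.
  have tX2 : (t \o* X)%R \in L2 by apply: Lfun_scale => //; rewrite ler1n.
  have tXZ : ip (t \o* X)%R Z = (t * ip X Z)%R.
    rewrite /ip -RintegralZl//; last exact: L2_mul_integrable.
    by apply: eq_Rintegral => w _ /=; ring.
  have tXX : ip (t \o* X)%R (t \o* X)%R = (t ^+ 2 * ip X X)%R.
    rewrite /ip -RintegralZl//; last exact: L2_mul_integrable.
    by apply: eq_Rintegral => w _ /=; ring.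
  have := ip_ge0 (t \o* X \- Z)%R; have := ip_ge0 (t \o* X \+ Z)%R.
  rewrite ip_add_sqr// ip_sub_sqr// tXZ tXX ZZ => h1 h2.
  by case: (ger0P (ip X Z)) => ?; lra.
apply/eqP; rewrite -normr_eq0 eq_le normr_ge0 andbT leNgt; apply/negP => p0.
have XX := ip_ge0 X.
pose t := (`|ip X Z| / (ip X X + 1))%R.
have t0 : (0 < t)%R by rewrite divr_gt0// ltr_wpDl.
have tp : (t * (ip X X + 1) = `|ip X Z|)%R by rewrite divfK// gt_eqF// ltr_wpDl.
have := h t (ltW t0); rewrite -subr_ge0.
have -> : (t ^+ 2 * ip X X - 2 * t * `|ip X Z| = - (t * (`|ip X Z| + t)))%R.
  by rewrite -tp; ring.
by apply/negP; rewrite -ltNge oppr_lt0 mulr_gt0// addr_gt0.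
Qed.

End L2.

Section projection.
Context d (T : measurableType d) (R : realType) (P : probability T R).
Variable G : set (set T).
Hypothesis GT : G `<=` measurable.
Implicit Types V W Y Z : T -> R.
Notation N := (g_sigma_algebraType G).
Notation L2 := (Lfun P 2%:E).

(** A relation, satisfied by every version of the projection, so that chosen versions can be
    compared although the choice is not linear. *)
Definition is_proj V Z : Prop :=
  [/\ Z \in L2, measurable_fun [set: N] (Z : N -> R) &
    forall W, W \in L2 -> measurable_fun [set: N] (W : N -> R) ->
      ip P (V \- Z)%R W = 0%R].

Lemma condE_proj Y : Y \in L2 -> is_proj Y (condE P G Y).
Proof.
move=> Y2; have iY := L2_integrable Y2.
have mY : measurable_fun setT Y := L2_measurable Y2.
have [mZ Z1 ZE] := condEP GT iY; set Z := condE P G Y in mZ Z1 ZE *.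
have mZT : measurable_fun setT Z := sub_sigma_measurable_fun GT mZ.
have iZ : P.-integrable setT (EFin \o Z) by exact/Lfun1_integrable.
pose D := (Y \- Z)%R.
have iD : P.-integrable setT (EFin \o D).
  exact: (integrableB measurableT iY iZ).
have D0 A : <<s G >> A -> \int[P]_(w in A) (D w)%:E = 0.
  move=> sA; have mA := sub_sigma_measurable GT sA.
  rewrite integralB_EFin//; last 2 first.
  - exact: integrableS iY.
  - exact: integrableS iZ.
  rewrite -ZE// subee// integrable_fin_num//; exact: integrableS iZ.
(* Square-integrability of [Z] is not known yet. The truncations [Zn] are admissible test functions,
   orthogonality bounds their norms by that of [Y], and monotone convergence gives [Z] itself. *)
pose A n : set N := [set w | (`|Z w| <= n%:R)%R].
have mA n : measurable (A n).
  rewrite -[A n]setTI; apply: (@measurable_fun_le _ N R setT) => //.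
  exact: measurableT_comp.
pose Zn n : T -> R := (Z \* \1_(A n))%R.
have mZn n : measurable_fun [set: N] (Zn n : N -> R).
  by apply: measurable_funM => //; exact: measurable_indic.
have mZnT n := sub_sigma_measurable_fun GT (mZn n).
have Zn_le n w : (`|Zn n w| <= n%:R)%R.
  rewrite /Zn /= indicE; have [/set_mem wA|wA] := boolP (w \in A n).
    by rewrite mulr1.
  by rewrite mulr0 normr0.
have Zn2 n : Zn n \in L2.
  apply: (L2_le _ (L2_cst P n%:R)) => // w; rewrite (le_trans (Zn_le n w))//.
  exact: ler_norm.
have YZn n : (ip P (Zn n) (Zn n) <= ip P Y Y)%R.
  have iDZ : P.-integrable setT (fun w => (D w * Zn n w)%:E).
    have : P.-integrable setT (fun w => (n%:R)%:E * (D w)%:E) by exact: integrableZl.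
    apply: le_integrable => //.
      apply/measurable_EFinP; apply: measurable_funM => //.
      exact: measurable_funB.
    move=> w _; rewrite -EFinM !abse_EFin lee_fin [leLHS]normrM [leRHS]normrM mulrC.
    by apply: ler_wpM2r => //; rewrite (le_trans (Zn_le n w))// ler_norm.
  have := integral_mul_eq0 GT iD D0 (mZn n) iDZ.
  have -> : \int[P]_w (D w * Zn n w)%:E = (ip P Y (Zn n) - ip P (Zn n) (Zn n))%:E.
    rewrite -ipBl// -ipE//; last exact: L2B.
    rewrite unlock; apply: eq_integral => w _; rewrite /D /Zn /= indicE.
    by case: (_ \in _); rewrite ?mulr1// !mulr0.
  move=> [] YZ; have := ip_ge0 P (Y \- Zn n)%R; rewrite ip_sub_sqr//; lra.
have Z2 : Z \in L2.
  apply/L2P => //; apply: (@le_lt_trans _ _ (ip P Y Y)%:E); last exact: ltry.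
  have Zlim : \int[P]_w (Zn n w ^+ 2)%:E @[n --> \oo] --> \int[P]_w (Z w ^+ 2)%:E.
    have ZnZ w : (Zn n w ^+ 2)%:E @[n --> \oo] --> (Z w ^+ 2)%:E.
      apply: cvg_near_cst; near=> n; congr (_ ^+ 2)%:E.
      rewrite /Zn /= indicE mem_set ?mulr1//.
      near: n; exact: nbhs_infty_ger.
    under eq_integral do rewrite -(cvg_lim _ (ZnZ _))//.
    apply: cvg_monotone_convergence => //.
    - by move=> n; apply/measurable_EFinP; exact: measurable_funX.
    - by move=> n w _; rewrite lee_fin sqr_ge0.
    - move=> w _ n m nm; rewrite lee_fin /Zn /= !indicE.
      have [/set_mem wA|wA] := boolP (w \in A n); last by rewrite mulr0 expr0n sqr_ge0.
      rewrite mem_set// /A /=; apply: (le_trans wA); by rewrite ler_nat.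
  rewrite -(cvg_lim _ Zlim)//; apply: lime_le; first by apply/cvg_ex; eexists; exact: Zlim.
  by apply: nearW => n; have := YZn n; rewrite -lee_fin -(ip_sqrE (Zn2 n)) unlock.
split => // W W2 mW.
have iDW : P.-integrable setT (fun w => (D w * W w)%:E).
  by apply: L2_mul_integrable => //; exact: L2B.
have := integral_mul_eq0 GT iD D0 mW iDW.
by rewrite /ip /Rintegral => ->.
Unshelve. all: by end_near. Qed.

Lemma proj_sub V Z V' Z' : V \in L2 -> V' \in L2 ->
  is_proj V Z -> is_proj V' Z' -> is_proj (V \- V')%R (Z \- Z')%R.
Proof.
move=> V2 V'2 [Z2 mZ ZP] [Z'2 mZ' Z'P]; split.
- exact: L2B.
- exact: measurable_funB.
move=> W W2 mW.
have -> : ((V \- V') \- (Z \- Z'))%R = ((V \- Z) \- (V' \- Z'))%R.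
  by apply/funext => w /=; ring.
by rewrite ipBl ?ZP ?Z'P ?subrr//; exact: L2B.
Qed.

Lemma proj_min V Z W : V \in L2 -> is_proj V Z -> W \in L2 ->
  measurable_fun [set: N] (W : N -> R) ->
  (ip P (V \- Z)%R (V \- Z)%R <= ip P (V \- W)%R (V \- W)%R)%R.
Proof.
move=> V2 [Z2 mZ ZP] W2 mW.
have -> : (V \- W)%R = ((V \- Z) \+ (Z \- W))%R by apply/funext => w /=; ring.
have VZ2 := L2B V2 Z2; have ZW2 := L2B Z2 W2.
rewrite (ip_add_sqr VZ2 ZW2) (ZP _ ZW2); last exact: measurable_funB.
by rewrite mulr0 addr0 lerDl ip_ge0.
Qed.

Lemma proj_contraction V Z : V \in L2 -> is_proj V Z ->
  (ip P (V \- Z)%R (V \- Z)%R <= ip P V V)%R.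
Proof.
move=> V2 VZ; have := proj_min V2 VZ (L2_cst P 0%R) (@measurable_cst _ _ N _ setT _).
rewrite (_ : (V \- cst 0)%R = V)//; by apply/funext => w /=; rewrite subr0.
Qed.

Lemma proj_unique V Z Z' : V \in L2 -> is_proj V Z -> is_proj V Z' ->
  ip P (Z \- Z')%R (Z \- Z')%R = 0%R.
Proof.
move=> V2 [Z2 mZ ZP] [Z'2 mZ' Z'P].
have ZZ2 := L2B Z2 Z'2.
have mZZ : measurable_fun [set: N] ((Z \- Z')%R : N -> R) by exact: measurable_funB.
rewrite {1}(_ : (Z \- Z')%R = ((V \- Z') \- (V \- Z))%R); last first.
  by apply/funext => w /=; ring.
have VZ2 := L2B V2 Z2; have VZ'2 := L2B V2 Z'2.
by rewrite ipBl// ZP// Z'P// subrr.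
Qed.

End projection.

(** * Limits of nonnegative series *)

Section series_lemmas.
Context {R : realType}.
Implicit Types u v : nat -> \bar R.

Lemma le0_of_cvg0 (a : R) u : (forall n, a%:E <= u n) -> u @ \oo --> 0 -> (a <= 0)%R.
Proof.
move=> au u0; rewrite -lee_fin -[leRHS](cvg_lim _ u0)//.
apply: lime_ge; first by apply/cvg_ex; eexists; exact: u0.
exact: nearW.
Qed.

Lemma cvge0_le u (r : R) : (0 < r)%R -> u @ \oo --> 0 ->
  \forall n \near \oo, u n <= r%:E.
Proof.
move=> r0 /fine_cvgP[ufin /cvgr0Pnorm_le/(_ r r0) ur].
near=> n; rewrite -[u n]fineK; last by near: n; exact: ufin.
by rewrite lee_fin (le_trans (ler_norm _))//; near: n; exact: ur.
Unshelve. all: by end_near. Qed.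

Lemma ge0_cvge0 u : (forall n, 0 <= u n) ->
  (forall r : R, (0 < r)%R -> \forall n \near \oo, u n <= r%:E) -> u @ \oo --> 0.
Proof.
move=> u0 ur.
have ufin (r : R) n : u n <= r%:E -> u n \is a fin_num.
  by move=> unr; rewrite ge0_fin_numE// (le_lt_trans unr) ?ltry.
apply/fine_cvgP; split.
  by apply: filterS (ur 1%R ltr01) => n /=; exact: ufin.
apply/cvgr0Pnorm_le => r r0; apply: filterS (ur r r0) => n unr /=.
by rewrite ger0_norm ?fine_ge0// -lee_fin fineK//; exact: ufin unr.
Qed.

Lemma nneseries_ge_term u k : (forall n, 0 <= u n) -> u k <= \sum_(n <oo) u n.
Proof.
move=> u0; rewrite (le_trans _ (nneseries_lim_ge k.+1 _))//=.
by rewrite big_nat_recr//= leeDr// sume_ge0.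
Qed.

(* Dominated convergence for series: the dominating sequences [b + x n] may
   depend on [n], provided that the sums of the [x n] vanish in the limit. *)
Lemma nneseries_dominated_cvg0 (a x : nat -> nat -> R) (b e : nat -> R) (c : R) :
  (0 <= c)%R -> (forall n k, 0 <= a n k)%R -> (forall n k, 0 <= x n k)%R ->
  (forall k, 0 <= b k)%R ->
  (forall n k, a n k <= c * e n)%R -> e @ \oo --> 0%R ->
  (forall n k, a n k <= c * (b k + x n k))%R ->
  \sum_(k <oo) (b k)%:E < +oo ->
  (fun n => \sum_(k <oo) (x n k)%:E) @ \oo --> 0 ->
  (fun n => \sum_(k <oo) (a n k)%:E) @ \oo --> 0.
Proof.
move=> c0 a0 x0 b0 ae e0 abx bfin xcvg.
have Eb0 k : 0 <= (b k)%:E by rewrite lee_fin.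
have Ex0 n k : 0 <= (x n k)%:E by rewrite lee_fin.
have Ea0 n k : 0 <= (a n k)%:E by rewrite lee_fin.
have tail := nneseries_tail_cvg bfin (fun k _ => Eb0 k).
apply: ge0_cvge0 => [n|r r0]; first exact: nneseries_ge0.
have c1 : (0 < c + 1)%R by rewrite ltr_wpDl.
(* The budget [r] is split in thirds: the first [K] terms cost at most one through [c * e n], the
   tails of [b] and of [x n] one each, being at most [c * s]. *)
pose s := (r / (3 * (c + 1)))%R.
have s0 : (0 < s)%R by rewrite divr_gt0// mulr_gt0.
have cs : (c * s <= r / 3)%R.
  have : (r = 3 * (s * (c + 1)))%R by rewrite /s; field; rewrite gt_eqF.
  by move=> ->; have := ltW s0; lra.
have [K _ /(_ K (leqnn K)) /= tailK] := cvge0_le s0 tail.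
have en : \forall n \near \oo, (K%:R * (c * e n) <= r / 3)%R.
  have r30 : (0 < r / 3)%R by rewrite divr_gt0.
  have : (fun n => K%:R * (c * e n))%R @ \oo --> (K%:R * (c * 0))%R.
    by apply: cvgM; [exact: cvg_cst|apply: cvgM => //; exact: cvg_cst].
  rewrite !mulr0 => /cvgr0Pnorm_le/(_ _ r30); apply: filterS => n.
  exact: le_trans (ler_norm _).
near=> n.
have xn : \sum_(k <oo) (x n k)%:E <= s%:E by near: n; exact: cvge0_le.
have en' : (K%:R * (c * e n) <= r / 3)%R by near: n.
rewrite (nneseries_split 0 K)// add0n.
have h1 : \sum_(0 <= k < K) (a n k)%:E <= (r / 3)%:E.
  rewrite sumEFin lee_fin; apply: le_trans en'.
  rewrite (le_trans (ler_sum_nat (G := fun=> c * e n)%R _))//.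
  by rewrite sumr_const_nat subn0 mulr_natl.
have h2 : \sum_(K <= k <oo) (a n k)%:E <= (c * (s + s))%:E.
  rewrite (@le_trans _ _ (\sum_(K <= k <oo) c%:E * ((b k)%:E + (x n k)%:E)))//.
    by apply: lee_nneseries => k _; rewrite ?lee_fin// -EFinD -EFinM lee_fin.
  rewrite nneseriesZl; last by move=> k _; rewrite -EFinD lee_fin addr_ge0.
  rewrite nneseriesD//.
  rewrite EFinM lee_pmul ?EFinD//.
  - by rewrite adde_ge0// nneseries_ge0.
  - rewrite leeD// (le_trans _ xn)// (nneseries_split 0 K)// add0n leeDr//.
    by rewrite sume_ge0.
by rewrite (le_trans (leeD h1 h2))// -EFinD lee_fin; lra.
Unshelve. all: by end_near. Qed.

End series_lemmas.

(** * The difference operators and the closure of [D] *)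

Section differences.
Context d (T : measurableType d) (R : realType) (P : probability T R).
Context (dE : nat -> measure_display) (E : forall n, measurableType (dE n)).
Context (X : forall n, {RV P >-> E n}).
Implicit Types (M : set nat) (F : T -> R).
Notation L2 := (Lfun P 2%:E).
Notation Gk k := (sigmaX X [set j | j <> k]).
Notation Dk := (Dk P X).

Lemma sigmaX_measurable M : sigmaX X M `<=` measurable.
Proof. by move=> A [j _ [B mB <-]]; exact: (measurable_funPT (X j) measurableT B mB). Qed.

Lemma measurable_wrt_sub M M' F : M `<=` M' ->
  measurable_wrt X M F -> measurable_wrt X M' F.
Proof.
move=> MM' mF _ B mB; have := mF measurableT B mB.
apply: sub_sigma_algebra2 => A [j Mj [C mC <-]].
by exists j; [exact: MM'|exists C].
Qed.

Lemma measurable_wrt_comp M (f : R -> R) F : measurable_fun setT f ->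
  measurable_wrt X M F -> measurable_wrt X M (f \o F).
Proof. by move=> mf mF; exact: measurableT_comp. Qed.

Lemma condE_G_proj k F : F \in L2 -> is_proj P (Gk k) F (condE_G P X k F).
Proof. by move=> F2; apply: condE_proj => //; exact: sigmaX_measurable. Qed.

Lemma condE_G_L2 k F : F \in L2 -> condE_G P X k F \in L2.
Proof. by move=> /condE_G_proj-/(_ k)[]. Qed.

Lemma Dk_L2 k F : F \in L2 -> Dk k F \in L2.
Proof. by move=> F2; apply: L2B => //; exact: condE_G_L2. Qed.

Lemma Dk_measurable_wrt k F : F \in L2 -> measurable_wrt X setT F ->
  measurable_wrt X setT (Dk k F).
Proof.
move=> F2 mF; apply: measurable_funB => //.
by have [_ mC _] := condE_G_proj k F2; exact: measurable_wrt_sub mC.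
Qed.

Lemma ip_Dk_eq0 k F W : F \in L2 -> W \in L2 ->
  measurable_wrt X [set j | j <> k] W -> ip P (Dk k F) W = 0%R.
Proof. by move=> F2 W2 mW; have [_ _] := condE_G_proj k F2; apply. Qed.

Lemma ip_Dk_sub k F F' : F \in L2 -> F' \in L2 ->
  (ip P (Dk k F \- Dk k F')%R (Dk k F \- Dk k F')%R <= ip P (F \- F')%R (F \- F')%R)%R.
Proof.
move=> F2 F'2.
have := proj_contraction (L2B F2 F'2)
  (proj_sub F2 F'2 (condE_G_proj k F2) (condE_G_proj k F'2)).
rewrite (_ : (_ \- (_ \- _))%R = (Dk k F \- Dk k F')%R)//.
by apply/funext => w; rewrite /Dk /=; ring.
Qed.

Section lipschitz.
Variables (f : R -> R) (M : R).
Hypothesis M0 : (0 <= M)%R.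
Hypothesis flip : forall x y, (`|f x - f y| <= M * `|x - y|)%R.

Lemma lipschitz_continuous : continuous f.
Proof.
move=> x; apply/cvgrPdist_le => /= r r0.
have M1 : (0 < M + 1)%R by rewrite ltr_wpDl.
exists (r / (M + 1))%R => /=; first by rewrite divr_gt0.
move=> y /= xy; rewrite (le_trans (flip _ _))//.
have := ltW xy; rewrite ler_pdivlMr//; apply: le_trans.
by rewrite mulrC ler_wpM2l// lerDl.
Qed.

Lemma lipschitz_measurable : measurable_fun setT f.
Proof. exact: continuous_measurable_fun lipschitz_continuous. Qed.

Lemma lipschitz_comp_sub_L2 F F' : F \in L2 -> F' \in L2 ->
  ((f \o F) \- (f \o F'))%R \in L2 /\
  (ip P ((f \o F) \- (f \o F'))%R ((f \o F) \- (f \o F'))%R <= M ^+ 2 * ip P (F \- F')%R (F \- F')%R)%R.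
Proof.
move=> F2 F'2; have FF2 := L2B F2 F'2.
have MFF2 : (M \o* (F \- F'))%R \in L2 by apply: Lfun_scale => //; rewrite ler1n.
have fle w : (`|((f \o F) \- (f \o F')) w| <= `|(M \o* (F \- F')) w|)%R.
  by rewrite /= normrM mulrC (ger0_norm M0).
have f2 : ((f \o F) \- (f \o F'))%R \in L2.
  apply: (L2_le _ MFF2) => //.
  by apply: measurable_funB; apply: (measurableT_comp lipschitz_measurable);
    [exact: L2_measurable F2|exact: L2_measurable F'2].
split => //; rewrite (le_trans (ip_le f2 MFF2 fle))//.
rewrite /ip -RintegralZl//; last exact: L2_mul_integrable.
by rewrite le_eqVlt; apply/orP; left; apply/eqP/eq_Rintegral => w _ /=; ring.
Qed.

End lipschitz.

Lemma sqnormE (U : nat -> T -> R) : (forall k, U k \in L2) ->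
  sqnorm_seq P U = \sum_(k <oo) (ip P (U k) (U k))%:E.
Proof. by move=> U2; apply: eq_eseriesr => k _; rewrite ip_sqrE. Qed.

Lemma L2seq_L2 (U : nat -> T -> R) (k : nat) : L2seq X U -> U k \in L2.
Proof.
move=> [mU Ufin].
have mUk : measurable_fun setT (U k).
  by apply: sub_sigma_measurable_fun (mU k); exact: sigmaX_measurable.
apply/L2P => //; apply: le_lt_trans Ufin.
have -> : \int[P]_w (U k w ^+ 2)%:E = 'E_P[fun w => (U k w ^+ 2)%R] by rewrite unlock.
apply: nneseries_ge_term => n; apply: expectation_ge0 => w; exact: sqr_ge0.
Qed.

Lemma L2X_L2 F : L2X X F -> F \in L2. Proof. by case. Qed.

(** Each [Dk k] is continuous in square mean, so the closure keeps its coordinates: both [U k] and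
    [Dk k F] are limits of [Dk k (Fn n)]. This ties the graph of [D] to the concrete differences. *)
Lemma is_D_Dk F (U : nat -> T -> R) (k : nat) : is_D X F U ->
  ip P (U k \- Dk k F)%R (U k \- Dk k F)%R = 0%R.
Proof.
move=> [[mF F2] LU [Fn [cFn cvF cvU]]].
have Fn2 n : Fn n \in L2 by have [/L2X_L2] := cFn n.
have Uk2 := L2seq_L2 k LU.
have D2 := Dk_L2 k F2.
have Dn2 n := Dk_L2 k (Fn2 n).
apply/eqP; rewrite eq_le ip_ge0 andbT.
pose u n := 2%:E * sqnorm_seq P (fun k => Dk k (Fn n) \- U k)%R +
  2%:E * 'E_P[fun w => ((Fn n w - F w) ^+ 2)%R].
apply: (@le0_of_cvg0 _ _ u) => [n|].
  apply: (@le_trans _ _ (2 * ip P (Dk k (Fn n) \- U k)%R (Dk k (Fn n) \- U k)%R +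
    2 * ip P (Dk k (Fn n) \- Dk k F)%R (Dk k (Fn n) \- Dk k F)%R)%:E).
    rewrite lee_fin [leRHS]addrC.
    rewrite {1 2}(_ : (U k \- Dk k F)%R = ((Dk k (Fn n) \- Dk k F) \- (Dk k (Fn n) \- U k))%R); last first.
      by apply/funext => w /=; ring.
    by apply: ip_sub_le; exact: L2B.
  rewrite EFinD !EFinM leeD// lee_wpmul2l ?lee_fin//.
    rewrite sqnormE; last by move=> j; apply: L2B; [exact: Dk_L2|exact: L2seq_L2].
    apply: (@nneseries_ge_term _ (fun j => (ip P (Dk j (Fn n) \- U j)%R (Dk j (Fn n) \- U j)%R)%:E)).
    by move=> j; rewrite lee_fin ip_ge0.
  rewrite (ip_sqrE (L2B (Fn2 n) F2)) lee_fin; exact: ip_Dk_sub.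
have -> : 0 = 2%:E * 0 + 2%:E * 0 :> \bar R by rewrite mule0 adde0.
by apply: cvgeD => //; apply: cvgeZl.
Qed.

End differences.

(** * Lipschitz functions of an element of the domain of [D] *)

Section duality.
Context d (T : measurableType d) (R : realType) (P : probability T R).
Context (dE : nat -> measure_display) (E : forall n, measurableType (dE n)).
Context (X : forall n, {RV P >-> E n}).
Implicit Types (F H W : T -> R) (U : nat -> T -> R) (k : nat).
Notation L2 := (Lfun P 2%:E).
Notation Gk k := (sigmaX X [set j | j <> k]).
Notation Dk := (Dk P X).
Notation Ck := (condE_G P X).

Lemma ip_eq V W : V \in L2 -> W \in L2 -> ip P (V \- W)%R (V \- W)%R = 0%R ->
  ip P W W = ip P V V.
Proof.
move=> V2 W2 VW; have VW2 := L2B V2 W2.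
rewrite {1 2}(_ : W = (V \- (V \- W))%R); last by apply/funext => w /=; ring.
by rewrite ip_sub_sqr// VW (ip_eq0 V2 VW2 VW) mulr0 subr0 addr0.
Qed.

Lemma Ck_measurable_wrt k F : F \in L2 -> measurable_wrt X [set j | j <> k] (Ck k F).
Proof. by move=> F2; have [] := condE_G_proj X k F2. Qed.

Lemma summable_Dk F U : is_D X F U -> \sum_(k <oo) (ip P (Dk k F) (Dk k F))%:E < +oo.
Proof.
move=> FU; have [[mF F2] LU _] := FU; have [_] := LU.
rewrite sqnormE; last by move=> k; exact: (L2seq_L2 k LU).
apply: le_lt_trans; apply: lee_nneseries => k _; first by rewrite lee_fin ip_ge0.
rewrite lee_fin (ip_eq _ _ (is_D_Dk k FU))//; first exact: (L2seq_L2 k LU).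
exact: Dk_L2.
Qed.

(** The versions chosen for [H] and for [- H] are unrelated; only uniqueness of projections up to
    null sets compares them. *)
Lemma DkN_ip k H : H \in L2 -> ip P (Dk k (\- H)%R \+ Dk k H)%R (Dk k (\- H)%R \+ Dk k H)%R = 0%R.
Proof.
move=> H2; have NH2 := L2N H2.
have [C2 mC CP] := condE_G_proj X k H2.
have pN : is_proj P (Gk k) (\- H)%R (\- Ck k H)%R.
  split; [exact: L2N|exact: measurableT_comp|move=> W W2 mW].
  rewrite (_ : (\- H \- (\- Ck k H))%R = ((cst 0) \- (H \- Ck k H))%R); last first.
    by apply/funext => w /=; ring.
  rewrite ipBl ?CP//; [|exact: L2_cst|exact: L2B].
  rewrite subr0 /ip; under eq_Rintegral do rewrite mul0r.
  by rewrite Rintegral_cst//= mul0r.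
have := proj_unique NH2 pN (condE_G_proj X k NH2).
rewrite (_ : (\- Ck k H \- _)%R = (Dk k (\- H)%R \+ Dk k H)%R)//.
by apply/funext => w; rewrite /Dk /=; ring.
Qed.

Section lipschitz.
Variables (f : R -> R) (M : R).
Hypothesis M0 : (0 <= M)%R.
Hypothesis flip : forall x y, (`|f x - f y| <= M * `|x - y|)%R.

Let mf : measurable_fun setT f. Proof. exact: lipschitz_measurable flip. Qed.

Lemma lipschitz_comp_L2 F : F \in L2 -> (f \o F) \in L2.
Proof.
move=> F2; have [f2 _] := lipschitz_comp_sub_L2 M0 flip F2 (L2_cst P 0%R).
rewrite (_ : f \o F = ((f \o F) \- (f \o cst 0%R)) \+ cst (f 0))%R.
  by apply: L2D => //; exact: L2_cst.
by apply/funext => w /=; ring.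
Qed.

(** [f \o Ck k F] is measurable for the smaller sigma-algebra, so it approximates [f \o F] no better
    than the projection does, and its error is at most [M] times [Dk k F]. *)
Lemma ip_Dk_lipschitz k F : F \in L2 ->
  (ip P (Dk k (f \o F)) (Dk k (f \o F)) <= M ^+ 2 * ip P (Dk k F) (Dk k F))%R.
Proof.
move=> F2; have [C2 mC _] := condE_G_proj X k F2; have fF2 := lipschitz_comp_L2 F2.
have [_] := lipschitz_comp_sub_L2 M0 flip F2 C2; apply: le_trans.
apply: (proj_min fF2 (condE_G_proj X k fF2)); first exact: lipschitz_comp_L2.
exact: measurable_wrt_comp.
Qed.

(** The approximations are [f \o Fn n]. The coordinate errors are uniformly small but not uniformly
    summable; the differences of [F] and the errors of [Fn n] dominate them. *)
Lemma is_D_lipschitz F U : is_D X F U -> is_D X (f \o F) (fun k => Dk k (f \o F)).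
Proof.
move=> FU; have [[mF F2] LU [Fn [cFn cvF cvU]]] := FU.
have fF2 := lipschitz_comp_L2 F2.
have mfF : measurable_wrt X setT (f \o F) by exact: measurable_wrt_comp.
have Fn2 n : Fn n \in L2 by have [/L2X_L2] := cFn n.
have fFn2 n := lipschitz_comp_L2 (Fn2 n).
have U2 k := L2seq_L2 k LU.
have D2 k := Dk_L2 X k F2; have Dn2 n k := Dk_L2 X k (Fn2 n).
have fD2 k := Dk_L2 X k fF2; have fDn2 n k := Dk_L2 X k (fFn2 n).
have Dsum := summable_Dk FU.
have cve : (fun n => ip P (Fn n \- F)%R (Fn n \- F)%R) @ \oo --> 0%R.
  apply: (@fine_cvg _ _ _ _ (EFin \o (fun n => ip P (Fn n \- F)%R (Fn n \- F)%R))).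
  rewrite (_ : _ \o _ = fun n => 'E_P[fun w => ((Fn n w - F w) ^+ 2)%R])//.
  by apply/funext => n /=; rewrite -ip_sqrE//; exact: L2B.
have fFF n := (lipschitz_comp_sub_L2 M0 flip (Fn2 n) F2).
split.
- by split.
- split=> [k|]; first exact: Dk_measurable_wrt.
  rewrite (sqnormE fD2).
  apply: (@le_lt_trans _ _ (\sum_(k <oo) (M ^+ 2)%:E * (ip P (Dk k F) (Dk k F))%:E)).
    apply: lee_nneseries => k _; first by rewrite lee_fin ip_ge0.
    by rewrite -EFinM lee_fin ip_Dk_lipschitz.
  rewrite nneseriesZl; last by move=> k _; rewrite lee_fin ip_ge0.
  by rewrite lte_mul_pinfty ?lee_fin ?sqr_ge0.
exists (fun n => f \o Fn n); split.
- move=> n; have [_ [m mFn]] := cFn n; split; last by exists m; exact: measurable_wrt_comp.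
  by split => //; apply: measurable_wrt_comp => //; have [[]] := cFn n.
- have cvMe : (fun n => (M ^+ 2 * ip P (Fn n \- F)%R (Fn n \- F)%R)%:E) @ \oo --> 0.
    apply/cvg_EFin; first exact: nearW.
    by rewrite -(mulr0 (M ^+ 2)%R); apply: cvgM => //; exact: cvg_cst.
  apply: (squeeze_cvge _ (cvg_cst 0) cvMe); apply: nearW => n.
  rewrite expectation_ge0/=; last by move=> w; exact: sqr_ge0.
  by have [h2 h] := fFF n; rewrite (ip_sqrE h2) lee_fin.
rewrite (_ : (fun n => _) = (fun n => \sum_(k <oo)
    (ip P (Dk k (f \o Fn n) \- Dk k (f \o F))%R (Dk k (f \o Fn n) \- Dk k (f \o F))%R)%:E)); last first.
  by apply/funext => n; rewrite sqnormE// => k; exact: L2B.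
(* The constant: with [b] and [x] the squares of [Dk k F] and of [Dk k (Fn n) - U k], the square of
   [Dk k (Fn n)] is at most [2 x + 2 b]. The error is then at most [2 M^2 (2 x + 2 b) + 2 M^2 b],
   below [6 M^2 (b + x)]. *)
apply: (@nneseries_dominated_cvg0 _ _
  (fun n k => ip P (Dk k (Fn n) \- U k)%R (Dk k (Fn n) \- U k)%R)
  (fun k => ip P (Dk k F) (Dk k F))
  (fun n => ip P (Fn n \- F)%R (Fn n \- F)%R) (6 * M ^+ 2)%R) => //.
- by rewrite mulr_ge0// sqr_ge0.
- by move=> n k; exact: ip_ge0.
- by move=> n k; exact: ip_ge0.
- by move=> k; exact: ip_ge0.
- move=> n k; have [h2 h] := fFF n.
  rewrite (le_trans (ip_Dk_sub X k (fFn2 n) fF2))// (le_trans h)//.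
  by rewrite ler_wpM2r ?ip_ge0//; have := sqr_ge0 M; lra.
- move=> n k; rewrite (le_trans (ip_sub_le (fDn2 n k) (fD2 k)))//.
  have h1 := ip_Dk_lipschitz k (Fn2 n); have h2 := ip_Dk_lipschitz k F2.
  have := ip_sub_le (L2B (Dn2 n k) (U2 k)) (L2N (U2 k)).
  rewrite (_ : (Dk k (Fn n) \- U k \- (\- U k))%R = Dk k (Fn n)); last first.
    by apply/funext => w /=; ring.
  have -> : ip P (\- U k)%R (\- U k)%R = ip P (U k) (U k).
    by apply: eq_Rintegral => w _ /=; ring.
  rewrite -(ip_eq (U2 k) (D2 k) (is_D_Dk k FU)).
  have x0 := ip_ge0 P (Dk k (Fn n) \- U k)%R; have b0 := ip_ge0 P (Dk k F).
  have M20 := sqr_ge0 M; move=> h3; move: h1 h2 x0 b0 h3 M20.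
  move: (M ^+ 2)%R (ip P _ _) (ip P _ _) (ip P _ _) (ip P _ _) (ip P _ _).
  by move=> m a b c e g h1 h2 x0 b0 /(ler_wpM2l _) + m0 => /(_ m m0); have := mulr_ge0 m0 x0; lra.
rewrite (_ : (fun n => _) = (fun n => sqnorm_seq P (fun k => Dk k (Fn n) \- U k)%R))//.
by apply/funext => n; rewrite sqnormE// => k; exact: L2B.
Qed.

End lipschitz.
End duality.

(** * Measurability and integration of limits of series *)

Section convergence.
Context {R : realType}.

Lemma cvg_series_summable (a : nat -> R) :
  \sum_(k <oo) `|a k|%:E < +oo -> cvgn (series a).
Proof.
move=> sa; apply: normed_cvg; apply: nondecreasing_is_cvgn.
  by apply: nondecreasing_series => k _ _; exact: normr_ge0.
exists (fine (\sum_(k <oo) `|a k|%:E)) => _ [n _ <-].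
rewrite -lee_fin fineK; last by rewrite ge0_fin_numE// nneseries_ge0.
by rewrite /series /= -sumEFin; apply: nneseries_lim_ge.
Qed.

Lemma nneseries_lim_series (a : nat -> R) : cvgn (series a) ->
  \sum_(k <oo) (a k)%:E = (limn (series a))%:E.
Proof.
move=> ca; rewrite -EFin_lim//; congr (limn _); apply/funext => n.
by rewrite /series /= sumEFin.
Qed.

Lemma limn_einf_esup_cvg (u : nat -> \bar R) : limn_esup u <= limn_einf u ->
  u @ \oo --> limn_esup u.
Proof.
move=> ule; apply: (@squeeze_cvge _ _ _ _ (einfs u) u (esups u)).
- apply: nearW => n; apply/andP; split.
    by apply: ereal_inf_lbound; exists n => /=.
  by apply: ereal_sup_ubound; exists n => /=.
- have -> : limn_esup u = limn (einfs u).
    by apply/eqP; rewrite -limn_einf_lim eq_le ule limn_einf_sup.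
  exact: is_cvg_einfs.
- rewrite limn_esup_lim; exact: is_cvg_esups.
Qed.

(** Where the sequence diverges, [limn] is the default [point]. Convergence means that the upper
    limit is at most the lower one and is finite, and finiteness is tested by comparing with its own
    [fine] part; both conditions are measurable. *)
Lemma measurable_fun_limn d (T : measurableType d) (u : nat -> T -> R) :
  (forall n, measurable_fun [set: T] (u n)) ->
  measurable_fun [set: T] (fun w => limn (u ^~ w)).
Proof.
move=> mu; pose e n w := (u n w)%:E.
have me n : measurable_fun [set: T] (e n) by exact/measurable_EFinP.
have mS : measurable_fun [set: T] (fun w => limn_esup (e ^~ w)).
  exact: measurable_fun_limn_esup.
have mI : measurable_fun [set: T] (fun w => limn_einf (e ^~ w)).
  rewrite (_ : (fun _ => _) = (fun w => - limn_esup (fun n => - e n w))).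
    apply: measurableT_comp => //; apply: measurable_fun_limn_esup => n.
    exact: measurableT_comp.
  apply/funext => w; rewrite -[LHS]oppeK -limn_esupN//.
rewrite (_ : (fun w => _) = (fun w => if (limn_esup (e ^~ w) <= limn_einf (e ^~ w)) &&
    (((fine (limn_esup (e ^~ w)))%:E <= limn_esup (e ^~ w)) &&
     (limn_esup (e ^~ w) <= (fine (limn_esup (e ^~ w)))%:E))
    then fine (limn_esup (e ^~ w)) else point)).
  have mf : measurable_fun [set: T] (fun w => fine (limn_esup (e ^~ w))).
    by apply: measurableT_comp => //; exact: fine_measurable.
  have mEf : measurable_fun [set: T] (fun w => (fine (limn_esup (e ^~ w)))%:E).
    exact/measurable_EFinP.
  apply: measurable_fun_ifT => //; apply: measurable_and.
    exact: measurable_fun_lee.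
  by apply: measurable_and; exact: measurable_fun_lee.
apply/funext => w; case: ifPn => [/and3P[le1 le2 le3]|].
  have cv := limn_einf_esup_cvg le1.
  have fE : limn_esup (e ^~ w) = (fine (limn_esup (e ^~ w)))%:E.
    by apply/eqP; rewrite eq_le le2 le3.
  rewrite fE in cv; apply: (cvg_lim (@Rhausdorff _)).
  exact: (fine_cvg cv).
move=> ncv; apply: dvgP => /cvg_ex[l ul].
have el : (e ^~ w) @ \oo --> l%:E by apply: cvg_EFin; [exact: nearW|exact: ul].
by have [iE sE] := cvg_limn_einf_sup el; move: ncv; rewrite iE sE /= !lexx.
Qed.

End convergence.

Section series_L1.
Context d (T : measurableType d) (R : realType) (P : probability T R).
Variable t : nat -> T -> R.
Hypothesis mt : forall k, measurable_fun [set: T] (t k).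
Hypothesis t_sum : \sum_(k <oo) 'E_P[fun w => `|t k w|%R] < +oo.

(** Dominated by [|c|] plus the sum of the [|t k|], which is integrable. Where that sum is infinite,
    a null set, the limit may be a default value. *)
Lemma expectation_series_cvg (c : R) :
  'E_P[fun w => `|c - series (t ^~ w) n|%R] @[n --> \oo] -->
  'E_P[fun w => `|c - limn (series (t ^~ w))|%R].
Proof.
pose g w := `|c|%:E + \sum_(k <oo) `|t k w|%:E.
have mEt k : measurable_fun [set: T] (fun w => `|t k w|%:E).
  by apply/measurable_EFinP; exact: measurableT_comp.
have mg : measurable_fun [set: T] (fun w => \sum_(k <oo) `|t k w|%:E).
  by apply: (@ge0_emeasurable_sum _ _ _ setT (fun k w => `|t k w|%:E) xpredT).
have g0 w : 0 <= \sum_(k <oo) `|t k w|%:E by exact: nneseries_ge0.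
have it : P.-integrable [set: T] (fun w => \sum_(k <oo) `|t k w|%:E).
  apply/integrableP; split => //.
  under eq_integral do rewrite gee0_abs//.
  rewrite integral_nneseries//; apply: le_lt_trans t_sum.
  by apply: lee_nneseries => k _; rewrite ?integral_ge0// unlock.
have ig : P.-integrable [set: T] g.
  apply: integrableD => //.
  by apply/integrableP; split => //; rewrite integral_cst//= probability_setT mule1 ltry.
have ms n : measurable_fun [set: T] (fun w => series (t ^~ w) n).
  by apply: measurable_sum.
have mE n : measurable_fun [set: T] (fun w => `|c - series (t ^~ w) n|%:E).
  by apply/measurable_EFinP; apply: measurableT_comp => //; exact: measurable_funB.
have ml : measurable_fun [set: T] (fun w => `|c - limn (series (t ^~ w))|%:E).
  apply/measurable_EFinP; apply: measurableT_comp => //; apply: measurable_funB => //.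
  by apply: (@measurable_fun_limn R _ _ (fun n w => series (t ^~ w) n)).
have [||] := dominated_convergence measurableT mE ml _ ig.
- have := integrable_ae measurableT it; apply: filterS => w /(_ Logic.I).
  rewrite ge0_fin_numE// => tw _; have cv := cvg_series_summable tw.
  by apply: cvg_EFin; [exact: nearW|apply: cvg_norm; apply: cvgB => //; exact: cvg_cst].
- apply: aeW => w n _; rewrite abse_EFin normr_id.
  rewrite (@le_trans _ _ (`|c| + `|series (t ^~ w) n|)%:E)//.
    by rewrite lee_fin ler_normB.
  rewrite EFinD leeD2l//; apply: le_trans (nneseries_lim_ge n _) => //.
  by rewrite sumEFin lee_fin /series /= ler_norm_sum.
by move=> _ _; rewrite unlock.
Qed.

End series_L1.

(** * Integration by parts through the adjoint of [D] *)

Section D_integration_by_parts.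
Context d (T : measurableType d) (R : realType) (P : probability T R).
Context (dE : nat -> measure_display) (E : forall n, measurableType (dE n)).
Context (X : forall n, {RV P >-> E n}).
Variables F H : T -> R.
Hypothesis domF : dom_D P X F.
Hypothesis LHF : is_L X H F.
Notation L2 := (Lfun P 2%:E).
Notation Dk := (Dk P X).
Notation Ck := (condE_G P X).

Lemma dom_D_L2 : F \in L2. Proof. by have [U [[]]] := domF. Qed.

Lemma is_L_L2 : H \in L2. Proof. by have [U [[[]]]] := LHF. Qed.

Lemma ip_abs_le (V W : T -> R) : V \in L2 -> W \in L2 ->
  (2 * ip P (fun w => `|V w|) (fun w => `|W w|) <= ip P V V + ip P W W)%R.
Proof.
move=> V2 W2; have V'2 := L2_normr V2; have W'2 := L2_normr W2.
have := ip_ge0 P ((fun w => `|V w|) \- (fun w => `|W w|))%R; rewrite ip_sub_sqr//.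
have h (Y : T -> R) : ip P (fun w => `|Y w|%R) (fun w => `|Y w|%R) = ip P Y Y.
  by apply: eq_Rintegral => w _; rewrite -normrM ger0_norm// -expr2 sqr_ge0.
by rewrite !h; lra.
Qed.

Lemma norm_ip_le (V W : T -> R) : V \in L2 -> W \in L2 ->
  (`|ip P V W| <= ip P (fun w => `|V w|) (fun w => `|W w|))%R.
Proof.
move=> V2 W2; rewrite /ip (le_trans (le_normr_Rintegral _ _))//.
  exact: L2_mul_integrable.
by rewrite le_eqVlt; apply/orP; left; apply/eqP/eq_Rintegral => w _; rewrite normrM.
Qed.

Lemma summable_ip_abs (V W : nat -> T -> R) : (forall k, V k \in L2) -> (forall k, W k \in L2) ->
  \sum_(k <oo) (ip P (V k) (V k))%:E < +oo ->
  \sum_(k <oo) (ip P (W k) (W k))%:E < +oo ->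
  \sum_(k <oo) (ip P (fun w => `|V k w|%R) (fun w => `|W k w|%R))%:E < +oo.
Proof.
move=> V2 W2 sV sW.
have V0 k : 0 <= (ip P (V k) (V k))%:E by rewrite lee_fin ip_ge0.
have W0 k : 0 <= (ip P (W k) (W k))%:E by rewrite lee_fin ip_ge0.
have i0 k : (0 <= ip P (fun w => `|V k w|) (fun w => `|W k w|))%R.
  by apply: Rintegral_ge0 => w _; exact: mulr_ge0.
apply: (@le_lt_trans _ _ (\sum_(k <oo) ((ip P (V k) (V k))%:E + (ip P (W k) (W k))%:E))).
  apply: lee_nneseries => k _; first by rewrite lee_fin.
  by rewrite -EFinD lee_fin; have := ip_abs_le (V2 k) (W2 k); have := i0 k; lra.
by rewrite nneseriesD// lte_add_pinfty.
Qed.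

Lemma DkN_ipE k W : W \in L2 -> ip P W (Dk k (\- H)%R) = (- ip P W (Dk k H))%R.
Proof.
move=> W2; have H2 := is_L_L2; have NH2 := L2N H2.
have D2 := Dk_L2 X k H2; have DN2 := Dk_L2 X k NH2.
have := ip_eq0 W2 (L2D DN2 D2) (DkN_ip X k H2).
by rewrite ipDr// => /eqP; rewrite addr_eq0 => /eqP.
Qed.

Lemma summable_Dk_Linv : \sum_(k <oo) (ip P (Dk k H) (Dk k H))%:E < +oo.
Proof. by have [U [HU _]] := LHF; exact: summable_Dk HU. Qed.

Lemma summable_DkN_Linv :
  \sum_(k <oo) (ip P (Dk k (\- H)%R) (Dk k (\- H)%R))%:E < +oo.
Proof.
have H2 := is_L_L2.
have D2 k := Dk_L2 X k H2; have DN2 k := Dk_L2 X k (L2N H2).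
rewrite (eq_eseriesr (g := fun k => (ip P (Dk k H) (Dk k H))%:E)).
  exact: summable_Dk_Linv.
by move=> k _; rewrite DkN_ipE// ipC DkN_ipE// opprK.
Qed.

Section lipschitz.
Variables (f : R -> R) (M : R).
Hypothesis M0 : (0 <= M)%R.
Hypothesis flip : forall x y, (`|f x - f y| <= M * `|x - y|)%R.

Lemma D_integration_by_parts :
  series (fun k => ip P ((f \o F) \- (f \o Ck k F))%R (Dk k (\- H)%R)) @ \oo -->
  ip P F (f \o F).
Proof.
have [U [HU [LU _ /(_ (f \o F))]]] := LHF; have [UF FU] := domF.
have fF := is_D_lipschitz M0 flip FU; move=> /(_ _ fF).
have F2 := dom_D_L2; have H2 := is_L_L2; have fF2 := lipschitz_comp_L2 M0 flip F2.
have U2 k := L2seq_L2 k LU; have D2 k := Dk_L2 X k fF2; have DH2 k := Dk_L2 X k H2.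
have C2 k := condE_G_L2 X k F2; have fC2 k := lipschitz_comp_L2 M0 flip (C2 k).
have mfC k : measurable_wrt X [set j | j <> k] (f \o Ck k F).
  apply: measurable_wrt_comp; first exact: (lipschitz_measurable M0 flip).
  exact: Ck_measurable_wrt.
have mCf k : measurable_wrt X [set j | j <> k] (Ck k (f \o F)).
  exact: Ck_measurable_wrt.
(* The two first factors differ by [Ck k (f \o F) - f \o Ck k F], which does not depend on
   coordinate [k] and is therefore orthogonal to [Dk k H]. *)
have DE k : ip P ((f \o F) \- (f \o Ck k F))%R (Dk k (\- H)%R) =
    (- ip P (Dk k (f \o F)) (U k))%R.
  rewrite DkN_ipE; last exact: L2B.
  congr (- _)%R.
  have -> : ip P (Dk k (f \o F)) (U k) = ip P (Dk k (f \o F)) (Dk k H).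
    have := ip_eq0 (D2 k) (L2B (U2 k) (DH2 k)) (is_D_Dk k HU).
    by rewrite ipBr// => /eqP; rewrite subr_eq0 => /eqP.
  have CfC2 := L2B (condE_G_L2 X k fF2) (fC2 k).
  have := ip_Dk_eq0 H2 CfC2 (measurable_funB (mCf k) (mfC k)).
  rewrite ipC => /(congr1 (fun x => ip P (Dk k (f \o F)) (Dk k H) + x))%R.
  rewrite addr0 -ipDl// => <-; congr ip.
  by apply/funext => w; rewrite /Dk /=; ring.
have summ : cvgn (series (fun k => ip P (Dk k (f \o F)) (U k))).
  apply: cvg_series_summable; have [_ [_]] := fF; rewrite (sqnormE D2) => sD _.
  have [_ sU] := LU; rewrite (sqnormE U2) in sU.
  apply: le_lt_trans (summable_ip_abs D2 U2 sD sU).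
  by apply: lee_nneseries => k _; rewrite lee_fin// norm_ip_le.
(* The terms of [dot_seq] may have both signs; absolute summability makes this extended limit a real
   one. *)
rewrite (_ : dot_seq _ _ _ = (limn (series (fun k => ip P (Dk k (f \o F)) (U k))))%:E); last first.
  by rewrite -nneseries_lim_series//; apply: eq_eseriesr => k _; rewrite ipE.
rewrite (ipE fF2 (L2N F2)) => -[] limE.
have -> : ip P F (f \o F) = (- ip P (f \o F) (\- F))%R.
  rewrite ipC -mulN1r /ip -RintegralZl//; last exact: L2_mul_integrable fF2 (L2N F2).
  by apply: eq_Rintegral => w _ /=; ring.
rewrite -limE; rewrite (_ : series _ = (\- series (fun k => ip P (Dk k (f \o F)) (U k)))%R).
  exact: cvgN summ.
apply/funext => n; rewrite /series /= -sumrN; apply: eq_bigr => k _; exact: DE.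
Qed.

End lipschitz.
End D_integration_by_parts.

Lemma cvge_le {R : realType} (u v : nat -> \bar R) (a b : \bar R) :
  u @ \oo --> a -> v @ \oo --> b -> (forall n, u n <= v n) -> a <= b.
Proof.
move=> ua vb uv; rewrite -(cvg_lim (@ereal_hausdorff R) ua) -(cvg_lim (@ereal_hausdorff R) vb).
by apply: lee_lim; [apply/cvg_ex; eexists; exact: ua|apply/cvg_ex; eexists; exact: vb|exact: nearW].
Qed.

Section Rintegral.
Context d (T : measurableType d) (R : realType) (P : probability T R).
Implicit Types u g : T -> R.

Lemma Rintegral_probability_cst (c : R) : (\int[P]_w c = c)%R.
Proof.
rewrite Rintegral_cst// (_ : fine _ = 1%R) ?mulr1//.
exact: (congr1 fine (probability_setT P)).
Qed.

Lemma Rintegral_series (u : nat -> T -> R) n :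
  (forall k, P.-integrable [set: T] (EFin \o u k)) ->
  P.-integrable [set: T] (EFin \o (fun w => series (u ^~ w) n)) /\
  (\int[P]_w series (u ^~ w) n = series (fun k => \int[P]_w u k w) n)%R.
Proof.
move=> iu; elim: n => [|n [iS IH]].
  rewrite (_ : (fun w => series (u ^~ w) 0%N) = cst 0%R); last first.
    by apply/funext => w; rewrite /series /= big_geq.
  rewrite Rintegral_probability_cst /series /= big_geq//; split => //.
  exact: L2_integrable (L2_cst P _).
rewrite (_ : (fun w => series _ n.+1) = (fun w => series (u ^~ w) n + u n w)%R); last first.
  by apply/funext => w; rewrite /series /= big_nat_recr.
rewrite RintegralD// IH /series /= big_nat_recr//; split => //.
exact: (integrableD measurableT iS (iu n)).
Qed.

Lemma Rintegral_mul_bounded_le u g (K : R) :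
  P.-integrable [set: T] (EFin \o u) -> measurable_fun [set: T] g ->
  (forall w, `|g w| <= K)%R ->
  (\int[P]_w (g w * u w))%R%:E <= K%:E * 'E_P[fun w => `|u w|%R].
Proof.
move=> iu mg gK.
have mu : measurable_fun [set: T] u by apply/measurable_EFinP; exact: measurable_int iu.
have K0 : (0 <= K)%R by rewrite (le_trans _ (gK point)).
have mgu : measurable_fun [set: T] (fun w => (g w * u w)%:E).
  by apply/measurable_EFinP; exact: measurable_funM.
have mnu : measurable_fun [set: T] (fun w => `|u w|%:E).
  by apply/measurable_EFinP; exact: measurableT_comp.
have igu : P.-integrable [set: T] (fun w => (g w * u w)%:E).
  apply: le_integrable (integrableZl measurableT K iu) => // w _.
  by rewrite -EFinM !abse_EFin lee_fin [leLHS]normrM [leRHS]normrM (ger0_norm K0) ler_wpM2r.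
rewrite /Rintegral fineK; last exact: integrable_fin_num.
rewrite (le_trans (lee_abs _))// (le_trans (le_abse_integral _ _ mgu))//.
rewrite unlock -ge0_integralZl//.
apply: ge0_le_integral => //.
- exact: measurableT_comp.
- by apply: emeasurable_funM => //; exact: measurable_cst.
- by move=> w _; rewrite -EFinM lee_fin normrM ler_wpM2r.
Qed.

End Rintegral.

(** * The estimate common to both distances *)

Section stein_method.
Context d (T : measurableType d) (R : realType) (P : probability T R).
Context (dE : nat -> measure_display) (E : forall n, measurableType (dE n)).
Context (X : forall n, {RV P >-> E n}).
Variables F H : T -> R.
Hypothesis domF : dom_D P X F.
Hypothesis LHF : is_L X H F.
Notation L2 := (Lfun P 2%:E).
Notation Dk := (Dk P X).
Notation Ck := (condE_G P X).
Notation A k := (Dk k (\- H)%R).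
Notation B k := (Dk k F).
Notation S := (fun n w => series (fun k => A k w * B k w)%R n).

Let F2 : F \in L2 := dom_D_L2 domF.
Let H2 : H \in L2 := is_L_L2 LHF.
Let A2 k : A k \in L2 := Dk_L2 X k (L2N H2).
Let B2 k : B k \in L2 := Dk_L2 X k F2.
Let mA k : measurable_fun [set: T] (A k) := L2_measurable (A2 k).
Let mB k : measurable_fun [set: T] (B k) := L2_measurable (B2 k).

Lemma L2_mul_bounded (Y g : T -> R) (K : R) : Y \in L2 ->
  measurable_fun [set: T] g -> (forall w, `|g w| <= K)%R ->
  (fun w => Y w * g w)%R \in L2.
Proof.
move=> Y2 mg gK.
have KY2 : (K \o* Y)%R \in L2 by apply: Lfun_scale => //; rewrite ler1n.
apply: (L2_le _ KY2) => [|w]; first by apply: measurable_funM => //; exact: L2_measurable Y2.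
by rewrite /= !normrM ler_wpM2l// (le_trans (gK w))// ler_norm.
Qed.

Lemma measurable_fun_series (a b : nat -> T -> R) n :
  (forall k, measurable_fun [set: T] (a k)) ->
  (forall k, measurable_fun [set: T] (b k)) ->
  measurable_fun [set: T] (fun w => series (fun k => a k w * b k w)%R n).
Proof. by move=> ma mb; apply: measurable_sum => k; exact: measurable_funM. Qed.

Lemma summable_Dk_dom : \sum_(k <oo) (ip P (B k) (B k))%:E < +oo.
Proof. by have [U FU] := domF; exact: summable_Dk FU. Qed.

Lemma expectation_mul_series_cvg (a : nat -> T -> R) (c : R) :
  (forall k, a k \in L2) -> \sum_(k <oo) (ip P (a k) (a k))%:E < +oo ->
  'E_P[fun w => `|c - series (fun k => a k w * B k w) n|%R] @[n --> \oo] -->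
  'E_P[fun w => `|c - limn (series (fun k => a k w * B k w))|%R].
Proof.
move=> a2 sa; apply: (expectation_series_cvg (t := fun k w => a k w * B k w)%R).
  by move=> k; apply: measurable_funM => //; exact: L2_measurable.
rewrite [ltLHS](_ : _ = \sum_(k <oo) (ip P (fun w => `|a k w|%R) (fun w => `|B k w|%R))%:E).
  exact: summable_ip_abs a2 B2 sa summable_Dk_dom.
apply: eq_eseriesr => k _; rewrite -ipE; [|exact: L2_normr|exact: L2_normr].
by congr expectation; apply/funext => w; rewrite normrM.
Qed.

Section estimate.
Variables (f df : R -> R) (M K : R) (rho : nat -> T -> R).
Hypothesis M0 : (0 <= M)%R.
Hypothesis flip : forall x y, (`|f x - f y| <= M * `|x - y|)%R.
Hypothesis mdf : measurable_fun [set: R] df.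
Hypothesis dfK : forall x, (`|df x| <= K)%R.
Hypothesis mrho : forall k, measurable_fun [set: T] (rho k).
Hypothesis frho : forall k w, (`|f (F w) - f (Ck k F w) - df (F w) * B k w| <= rho k w)%R.

Let term k w := (((f \o F) \- (f \o Ck k F)) w * A k w)%R.
Let q n w := (df (F w) - series (term ^~ w) n)%R.

Let mF : measurable_fun [set: T] F := L2_measurable F2.

Lemma comp_bounded_L2 : df \o F \in L2.
Proof.
apply: (L2_le _ (L2_cst P K)) => [|w]; first exact: measurableT_comp.
by rewrite (le_trans (dfK _))// ler_norm.
Qed.

Let term2 k : ((f \o F) \- (f \o Ck k F))%R \in L2.
Proof. by apply: L2B; apply: (lipschitz_comp_L2 M0 flip) => //; exact: condE_G_L2. Qed.

Let qP n : P.-integrable [set: T] (EFin \o q n) /\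
  (\int[P]_w q n w = \int[P]_w df (F w) -
    series (fun k => ip P ((f \o F) \- (f \o Ck k F))%R (A k)) n)%R.
Proof.
have it k : P.-integrable [set: T] (EFin \o term k) by exact: L2_mul_integrable.
have [iS sE] := Rintegral_series n it; have idf := L2_integrable comp_bounded_L2.
split; first exact: (integrableB measurableT idf iS).
by rewrite RintegralB// sE.
Qed.

Lemma stein_estimate n :
  `|\int[P]_w df (F w) -
    series (fun k => ip P ((f \o F) \- (f \o Ck k F))%R (A k)) n|%R%:E <=
  K%:E * 'E_P[fun w => `|1 - S n w|%R] +
  \sum_(0 <= k < n) 'E_P[fun w => (`|A k w| * rho k w)%R].
Proof.
have [iq qE] := qP n; have mq : measurable_fun [set: T] (EFin \o q n) by exact: measurable_int iq.
have K0 : (0 <= K)%R by apply: le_trans (dfK 0%R).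
have rho0 k w : (0 <= rho k w)%R by apply: le_trans (frho k w).
have mS : measurable_fun [set: T] (fun w => `|1 - S n w|%:E).
  apply/measurable_EFinP; apply: measurableT_comp => //; apply: measurable_funB => //.
  exact: measurable_fun_series.
have mAr k : measurable_fun [set: T] (fun w => (`|A k w| * rho k w)%:E).
  by apply/measurable_EFinP; apply: measurable_funM => //; exact: measurableT_comp.
have Ar0 k w : 0 <= (`|A k w| * rho k w)%:E by rewrite lee_fin mulr_ge0.
have msum : measurable_fun [set: T] (fun w => \sum_(0 <= k < n) (`|A k w| * rho k w)%:E).
  exact: emeasurable_sum.
rewrite -qE -abse_EFin /Rintegral fineK; last exact: integrable_fin_num.
rewrite (le_trans (le_abse_integral _ _ mq))//.
apply: (@le_trans _ _ (\int[P]_w (K%:E * `|1 - S n w|%:E + \sum_(0 <= k < n) (`|A k w| * rho k w)%:E))).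
  apply: ge0_le_integral => //.
  - exact: measurableT_comp.
  - by apply: emeasurable_funD => //; apply: emeasurable_funM => //; exact: measurable_cst.
  move=> w _; rewrite sumEFin -EFinM -EFinD lee_fin /=.
  (* The linear part of each increment of [f] joins the partial sum [S n], and what remains is
     bounded by [rho]. *)
  have -> : (q n w = df (F w) * (1 - S n w) -
      \sum_(0 <= k < n) (f (F w) - f (Ck k F w) - df (F w) * B k w) * A k w)%R.
    rewrite /q /series /= mulrBr mulr1 mulr_sumr -addrA -opprD -big_split /=; congr (_ - _)%R.
    by apply: eq_bigr => k _; rewrite /term /=; ring.
  rewrite (le_trans (ler_normB _ _))// lerD//; first by rewrite normrM ler_wpM2r.
  rewrite (le_trans (ler_norm_sum _ _ _))//; apply: ler_sum => k _.
  by rewrite normrM mulrC ler_wpM2l.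
rewrite ge0_integralD//; last 3 first.
- by move=> w _; rewrite -EFinM lee_fin mulr_ge0.
- by apply: emeasurable_funM => //; exact: measurable_cst.
- by move=> w _; apply: sume_ge0.
rewrite ge0_integralZl//.
rewrite ge0_integral_sum// leeD//; first by rewrite unlock.
by apply: lee_sum => k _; rewrite unlock.
Qed.

(** The bound [r] may vary with [n]: for Kolmogorov it contains the expectation of the modulus of a
    partial sum, which need not be monotone. *)
Lemma stein_estimate_lim (r : nat -> \bar R) (b : \bar R) : 0 <= b -> r @ \oo --> b ->
  (forall n, \sum_(0 <= k < n) 'E_P[fun w => (`|A k w| * rho k w)%R] <= r n) ->
  `|\int[P]_w df (F w) - ip P F (f \o F)|%R%:E <=
  K%:E * 'E_P[fun w => `|1 - limn (series (fun k => A k w * B k w))|%R] + b.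
Proof.
move=> b0 rb rle.
have K0 : (0 <= K)%R by apply: le_trans (dfK 0%R).
apply: (@cvge_le _ (fun n => `|\int[P]_w df (F w) -
    series (fun k => ip P ((f \o F) \- (f \o Ck k F))%R (A k)) n|%R%:E)
  (fun n => K%:E * 'E_P[fun w => `|1 - S n w|%R] + r n)).
- apply: cvg_EFin; first exact: nearW.
  apply: cvg_norm; apply: cvgB; first exact: cvg_cst.
  exact: (D_integration_by_parts domF LHF M0 flip).
- apply: cvgeD => //; first by rewrite ge0_adde_def// inE// mule_ge0// expectation_ge0.
  by apply: cvgeZl => //; apply: expectation_mul_series_cvg => //; exact: summable_DkN_Linv LHF.
move=> n; rewrite (le_trans (stein_estimate n))// leeD2l//.
Qed.

End estimate.
End stein_method.

(** * The Wasserstein and Kolmogorov bounds *)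

Section bounds.
Context d (T : measurableType d) (R : realType) (P : probability T R).
Context (dE : nat -> measure_display) (E : forall n, measurableType (dE n)).
Context (X : forall n, {RV P >-> E n}).
Variables F H : T -> R.
Hypothesis domF : dom_D P X F.
Hypothesis LHF : is_L X H F.
Notation L2 := (Lfun P 2%:E).
Notation Dk := (Dk P X).
Notation Ck := (condE_G P X).
Notation A k := (Dk k (\- H)%R).
Notation B k := (Dk k F).

Let F2 : F \in L2 := dom_D_L2 domF.
Let H2 : H \in L2 := is_L_L2 LHF.
Let A2 k : A k \in L2 := Dk_L2 X k (L2N H2).
Let B2 k : B k \in L2 := Dk_L2 X k F2.

Lemma smooth_wasserstein_bound (h dh : R -> R) :
  (forall x : R, is_derive x (1 : R)%R h (dh x)) -> (forall x, `|dh x| <= 1)%R ->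
  `|\int[P]_w h (F w) - stein_mean h|%R%:E <=
  (Num.sqrt (2 / pi))%:E *
    'E_P[fun w => `|1 - limn (series (fun k => A k w * B k w))|%R] +
  \sum_(k <oo) 'E_P[fun w => (`|A k w| * B k w ^+ 2)%R].
Proof.
move=> hdh dh1; pose f := stein_sol h; pose df := stein_dsol h.
have fdf (x : R) : is_derive x (1 : R)%R f (df x) by exact: is_derive_stein_sol hdh dh1 x.
have dfK x : (`|df x| <= Num.sqrt (2 / pi))%R by exact: stein_dsol_le hdh dh1 x.
have K0 : (0 <= Num.sqrt (2 / pi) :> R)%R by exact: sqrtr_ge0.
have flip x y : (`|f x - f y| <= Num.sqrt (2 / pi) * `|x - y|)%R.
  by have [c -> _] := MVT_between y x fdf; rewrite normrM ler_wpM2r.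
have hlip x y : (`|h x - h y| <= 1 * `|x - y|)%R.
  by have [c -> _] := MVT_between y x hdh; rewrite normrM ler_wpM2r.
have mh : measurable_fun [set: R] h by exact: lipschitz_measurable ler01 hlip.
have mf : measurable_fun [set: R] f by exact: lipschitz_measurable K0 flip.
have mdf : measurable_fun [set: R] df.
  apply: measurable_funB => //; apply: measurable_funD => //; exact: measurable_funM.
have hF2 : h \o F \in L2 by exact: (lipschitz_comp_L2 ler01 hlip).
have fF2 : f \o F \in L2 by exact: (lipschitz_comp_L2 K0 flip).
have -> : (\int[P]_w h (F w) - stein_mean h = \int[P]_w df (F w) - ip P F (f \o F))%R.
  rewrite [in RHS]/df /stein_dsol.
  rewrite RintegralB//; last 2 first.
  - apply: (integrableD measurableT (L2_mul_integrable F2 fF2) (L2_integrable hF2)).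
  - exact: (L2_integrable (L2_cst P _)).
  rewrite RintegralD//; [|exact: L2_mul_integrable F2 fF2|exact: L2_integrable hF2].
  rewrite Rintegral_probability_cst /ip.
  rewrite (_ : \int[P]_w (F w * stein_sol h (F w)) = \int[P]_w (F w * (f \o F) w))%R//.
  ring.
apply: (stein_estimate_lim domF LHF (rho := fun k w => (B k w ^+ 2)%R) K0 flip mdf dfK).
- by move=> k; apply: measurable_funX; exact: L2_measurable.
- move=> k w; have := stein_sol_taylor hdh dh1 (F w) (Ck k F w); rewrite -/f -/df.
  have -> : ((Ck k F w - F w) ^+ 2 = B k w ^+ 2)%R by rewrite /Dk /=; ring.
  rewrite -normrN; congr (`|_| <= _)%R; rewrite /Dk /=; ring.
- by apply: nneseries_ge0 => k _ _; apply: expectation_ge0 => w; rewrite mulr_ge0// sqr_ge0.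
- exact: cvg_cst.
- move=> n; apply: nneseries_lim_ge => k _ _.
  by apply: expectation_ge0 => w; rewrite mulr_ge0// sqr_ge0.
Qed.

Lemma wasserstein_bound d' (T' : measurableType d') (Q : probability T' R)
    (Z : {RV Q >-> R}) :
  (forall D : set R, measurable D -> distribution Q Z D = normal_prob 0 1 D) ->
  dWasserstein P F Q Z <=
  (Num.sqrt (2 / pi))%:E *
    'E_P[fun w => `|1 - limn (series (fun k => A k w * B k w))|%R] +
  \sum_(k <oo) 'E_P[fun w => (`|A k w| * B k w ^+ 2)%R].
Proof.
move=> lawZ; apply: ge_ereal_sup => _ [h hlip1 <-].
have hlip' x y : (`|h x - h y| <= `|x - y|)%R.
  by have := hlip1 (x, y) (conj Logic.I Logic.I); rewrite /= mul1r.
have hlip x y : (`|h x - h y| <= 1 * `|x - y|)%R by rewrite mul1r.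
have mh : measurable_fun [set: R] h by exact: lipschitz_measurable ler01 hlip.
have hF2 : h \o F \in L2 by exact: (lipschitz_comp_L2 ler01 hlip).
(* Smoothing costs [e / 2] in the expectation under [P] and [e / 2] under the normal law. *)
apply/lee_addgt0Pr => e e0; have e20 : (0 < e / 2)%R by rewrite divr_gt0.
have [he [dhe [hdh dh1 heh]]] := exists_smoothing e20 hlip'.
have := smooth_wasserstein_bound hdh dh1.
set r := (X in _ <= X -> _); move=> bound.
have helip x y : (`|he x - he y| <= 1 * `|x - y|)%R.
  by have [c -> _] := MVT_between y x hdh; rewrite normrM ler_wpM2r.
have mhe : measurable_fun [set: R] he by exact: lipschitz_measurable ler01 helip.
have heF2 : he \o F \in L2 by exact: (lipschitz_comp_L2 ler01 helip).
have ihe := integrable_lipschitz_phi hdh dh1.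
have ie : (@lebesgue_measure R).-integrable setT (EFin \o (fun t => cst (e / 2) t * phi t)%R).
  exact: (integrableZl measurableT (e / 2)%R (integrable_phi measurableT)).
have phi0 t : (0 <= phi t :> R)%R by exact/ltW/phi_gt0.
have mphi : measurable_fun [set: R] (@phi R).
  by apply: continuous_measurable_fun; exact: continuous_phi.
have id : (@lebesgue_measure R).-integrable setT (EFin \o (fun t => (he t - h t) * phi t)%R).
  apply: le_integrable ie => //.
    by apply/measurable_EFinP; apply: measurable_funM => //; exact: measurable_funB.
  by move=> t _; rewrite /= lee_fin [leLHS]normrM [leRHS]normrM ler_wpM2r// (le_trans (heh t))// ler_norm.
have ih : (@lebesgue_measure R).-integrable setT (EFin \o (fun t => h t * phi t)%R).
  rewrite (_ : _ \o _ = (EFin \o (fun t => he t * phi t)%R) \- (EFin \o (fun t => (he t - h t) * phi t)%R)).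
    exact: integrableB.
  by apply/funext => t /=; rewrite -EFinB; congr EFin; ring.
have EZ := expectation_normal lawZ mh ih.
have EP : 'E_P[h \o F] = (\int[P]_w h (F w))%R%:E.
  rewrite unlock /Rintegral fineK//; exact: (integrable_fin_num _ (L2_integrable hF2)).
rewrite EZ EP -EFinB abse_EFin.
have l1 : (`|\int[P]_w h (F w) - \int[P]_w he (F w)| <= e / 2)%R.
  rewrite -RintegralB//; [|exact: L2_integrable hF2|exact: L2_integrable heF2].
  have idF := integrableB measurableT (L2_integrable hF2) (L2_integrable heF2).
  rewrite (le_trans (le_normr_Rintegral _ idF))//.
  rewrite -[leRHS](Rintegral_probability_cst P); apply: le_Rintegral => //.
  - exact: integrable_norm.
  - exact: (L2_integrable (L2_cst P _)).
  - by move=> w _; rewrite distrC; exact: heh.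
have l2 : (`|stein_mean he - \int[lebesgue_measure]_t (h t * phi t)| <= e / 2)%R.
  rewrite /stein_mean -RintegralB//.
  have -> : (\int[lebesgue_measure]_t (he t * phi t - h t * phi t) =
      \int[lebesgue_measure]_t ((he t - h t) * phi t))%R.
    by apply: eq_Rintegral => t _; rewrite mulrBl.
  rewrite (le_trans (le_normr_Rintegral _ id))//.
  have <- : (\int[lebesgue_measure]_t (cst (e / 2) t * phi t) = e / 2 :> R)%R.
    have := expectation_normal lawZ (measurable_cst (e / 2)%R) ie.
    by rewrite (_ : _ \o Z = cst (e / 2)%R)// expectation_cst => -[].
  apply: le_Rintegral => //; first exact: integrable_norm.
  by move=> t _; rewrite normrM (ger0_norm (phi0 t)) ler_wpM2r.
apply: le_trans (leeD2r e%:E bound); rewrite -EFinD lee_fin.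
move: l1 l2; rewrite !ler_norml => /andP[? ?] /andP[? ?].
set u := (\int[P]_w he (F w) - stein_mean he)%R.
have := ler_norm u; have := ler_norm (- u)%R; rewrite normrN /u => ? ?.
by apply/andP; split; lra.
Qed.

Section kolmogorov.
Variable z : R.
Notation f := (stein_ind z).
Notation df := (stein_dind z).
Notation g := (stein_gind z).
Notation DH k := (fun w => `|Dk k H w|%R).
Notation c k := (Ck k (DH k)).
Notation rho k := (fun w => B k w * (g (F w) - g (Ck k F w)))%R.

Let DH2 k : Dk k H \in L2 := Dk_L2 X k H2.
Let nDH2 k : DH k \in L2 := L2_normr (DH2 k).
Let mF : measurable_fun [set: T] F := L2_measurable F2.
Let CF2 k : Ck k F \in L2 := condE_G_L2 X k F2.
Let c2 k : c k \in L2 := condE_G_L2 X k (nDH2 k).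

Let flip x y : (`|f x - f y| <= 1 * `|x - y|)%R.
Proof. by rewrite mul1r stein_ind_lipschitz. Qed.

Let mf : measurable_fun [set: R] f.
Proof. exact: lipschitz_measurable ler01 flip. Qed.

Let mind : measurable_fun [set: R] (fun x => ((x <= z)%R)%:R : R).
Proof.
rewrite (_ : (fun x => _) = (fun x => if (x <= z)%R then 1%R else 0%R)).
  by apply: measurable_fun_ifT => //; exact: measurable_fun_ler.
by apply/funext => x; case: (x <= z)%R.
Qed.

Let mdf : measurable_fun [set: R] df.
Proof.
by apply: measurable_funB => //; apply: measurable_funD => //; exact: measurable_funM.
Qed.

Let mg : measurable_fun [set: R] g.
Proof. by apply: measurable_funB => //; exact: measurable_funM. Qed.

Let mrho k : measurable_fun [set: T] (rho k).
Proof.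
apply: measurable_funM; first exact: L2_measurable.
by apply: measurable_funB; apply: measurableT_comp => //; exact: L2_measurable.
Qed.

Let rho2 k : rho k \in L2.
Proof.
apply: (@L2_mul_bounded _ _ _ _ _ _ 2%R) => // [|w]; last exact: stein_gind_osc.
by apply: measurable_funB; apply: measurableT_comp => //; exact: L2_measurable.
Qed.

Let DHE k : DH k = (Dk k (DH k) \+ c k)%R.
Proof. by apply/funext => w /=; rewrite -[LHS](subrK (c k w)). Qed.

(** [A k] equals [- Dk k H] only almost surely; the reverse triangle inequality carries this over to
    the absolute values. *)
Lemma ip_abs_rho k : ip P (fun w => `|A k w|)%R (rho k) = ip P (DH k) (rho k).
Proof.
have nA2 := L2_normr (A2 k).
suff /(ip_eq0 (rho2 k) (L2B nA2 (nDH2 k))) : ip P ((fun w => `|A k w|) \- DH k)%R ((fun w => `|A k w|) \- DH k)%R = 0%R.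
  rewrite (ipBr (rho2 k) nA2 (nDH2 k)) => /eqP; rewrite subr_eq0 => /eqP e.
  by rewrite ipC e ipC.
apply/eqP; rewrite eq_le ip_ge0 andbT -(DkN_ip X k H2); apply: ip_le.
- exact: L2B.
- exact: L2D.
- move=> w /=; have -> : (A k w + Dk k H w = A k w - - Dk k H w)%R by rewrite opprK.
  by rewrite -(normrN (Dk k H w)) ler_dist_dist.
Qed.

(** The second integral stays signed, without absolute values. Its factor [g (F w)] is the same for
    all [k], so the summation can later take place inside the expectation. *)
Lemma kolmogorov_remainder k :
  ip P (fun w => `|A k w|)%R (rho k) =
  (\int[P]_w (Dk k (DH k) w * B k w * (g (F w) - g (Ck k F w))) +
   \int[P]_w (g (F w) * (c k w * B k w)))%R.
Proof.
have gF2 : (fun w => c k w * g (F w))%R \in L2.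
  apply: (@L2_mul_bounded _ _ _ _ _ _ 2%R) => // [|w]; last exact: stein_gind_le2.
  exact: measurableT_comp.
have gC2 : (fun w => c k w * g (Ck k F w))%R \in L2.
  apply: (@L2_mul_bounded _ _ _ _ _ _ 2%R) => // [|w]; last exact: stein_gind_le2.
  by apply: measurableT_comp => //; exact: L2_measurable.
have orth : ip P (B k) (fun w => c k w * g (Ck k F w))%R = 0%R.
  apply: ip_Dk_eq0 => //; apply: measurable_funM; first exact: Ck_measurable_wrt.
  by apply: measurable_wrt_comp => //; exact: Ck_measurable_wrt.
have DDH2 : Dk k (DH k) \in L2 by exact: Dk_L2.
rewrite ip_abs_rho.
have -> : ip P (DH k) (rho k) = ip P (Dk k (DH k) \+ c k)%R (rho k) by rewrite -DHE.
rewrite ipDl//; congr (_ + _)%R.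
  by rewrite /ip; apply: eq_Rintegral => w _; ring.
transitivity (ip P (B k) (fun w => c k w * g (F w)) - ip P (B k) (fun w => c k w * g (Ck k F w)))%R.
  by rewrite -ipBr//; apply: eq_Rintegral => w _ /=; ring.
by rewrite orth subr0; apply: eq_Rintegral => w _; ring.
Qed.

(** By Pythagoras, [c k] has at most the norm of the function that it projects, [|Dk k H|]. *)
Lemma summable_condE_Linv : \sum_(k <oo) (ip P (c k) (c k))%:E < +oo.
Proof.
apply: le_lt_trans (summable_Dk_Linv LHF).
apply: lee_nneseries => [k _ _|k _]; first by rewrite lee_fin ip_ge0.
rewrite lee_fin; apply: (@le_trans _ _ (ip P (DH k) (DH k))); last first.
  by apply: ip_le => // w; rewrite normr_id.
have [_ mc cP] := condE_G_proj X k (nDH2 k).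
have D2 := Dk_L2 X k (nDH2 k).
have -> : ip P (DH k) (DH k) = ip P (Dk k (DH k) \+ c k)%R (Dk k (DH k) \+ c k)%R.
  by rewrite -DHE.
by rewrite ip_add_sqr// (ip_Dk_eq0 (nDH2 k) (c2 k) mc) mulr0 addr0 lerDr ip_ge0.
Qed.

Lemma kolmogorov_bound_at :
  `|P [set w | (F w <= z)%R] - (Phi z)%:E| <=
  'E_P[fun w => `|1 - limn (series (fun k => A k w * B k w))|%R] +
  2%:E * \sum_(k <oo) 'E_P[fun w => `|Dk k (DH k) w * B k w|%R] +
  2%:E * 'E_P[fun w => `|limn (series (fun k => c k w * B k w))|%R].
Proof.
have fF2 : f \o F \in L2 by exact: (lipschitz_comp_L2 ler01 flip).
pose D := [set w | (F w <= z)%R].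
have mD : measurable D.
  by rewrite -[D]setTI; exact: (measurable_fun_le measurableT mF (measurable_cst z)).
have -> : P D - (Phi z)%:E = (\int[P]_w df (F w) - ip P F (f \o F))%R%:E.
  have iD : P.-integrable [set: T] (EFin \o \1_D) by exact: integrable_indic.
  have -> : P D = (\int[P]_w \1_D w)%R%:E.
    rewrite /Rintegral integral_indic// setIT fineK//; exact: fin_num_measure.
  rewrite -EFinB; congr EFin; rewrite /stein_dind.
  have iFf := L2_mul_integrable F2 fF2.
  rewrite RintegralB//; last 2 first.
  - apply: (@eq_integrable _ _ _ _ _ measurableT ((fun w => (F w * (f \o F) w)%:E) \+ (EFin \o \1_D))).
      by move=> w _; rewrite /= indicE mem_setE.
    exact: integrableD.
  - exact: L2_integrable (L2_cst P _).
  rewrite RintegralD//; last first.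
    by apply: eq_integrable iD => // w _; rewrite /= indicE mem_setE.
  rewrite Rintegral_probability_cst /ip.
  have -> : (\int[P]_w ((F w <= z)%R)%:R = \int[P]_w \1_D w :> R)%R.
    by apply: eq_Rintegral => w _; rewrite indicE mem_setE.
  rewrite (_ : \int[P]_x (F x * f (F x)) = \int[P]_w (F w * (f \o F) w))%R//.
  ring.
rewrite abse_EFin -[X in _ <= X + _ + _]mul1e -addeA.
have s0 : 0 <= \sum_(k <oo) 'E_P[fun w => `|Dk k (DH k) w * B k w|%R].
  by apply: nneseries_ge0 => k _ _; exact: expectation_ge0.
pose r n := 2%:E * \sum_(k <oo) 'E_P[fun w => `|Dk k (DH k) w * B k w|%R] +
    2%:E * 'E_P[fun w => `|0 - series (fun k => c k w * B k w) n|%R].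
have taylor k w : (`|f (F w) - f (Ck k F w) - df (F w) * B k w| <= rho k w)%R.
  have := stein_ind_taylor z (F w) (Ck k F w).
  have -> : ((Ck k F w - F w) * (g (Ck k F w) - g (F w)) = rho k w)%R by rewrite /Dk /=; ring.
  rewrite -normrN; congr (`|_| <= _)%R; rewrite /Dk /=; ring.
apply: (stein_estimate_lim domF LHF ler01 flip mdf (@stein_dind_le1 _ z) mrho taylor (r := r)).
- by rewrite adde_ge0// mule_ge0// expectation_ge0.
- apply: cvgeD; first by rewrite ge0_adde_def// inE mule_ge0// expectation_ge0.
    exact: cvg_cst.
  apply: cvgeZl => //.
  rewrite (_ : (fun w => _) = (fun w => `|0 - limn (series (fun k => c k w * B k w))|%R)).
    by apply: (expectation_mul_series_cvg domF) => //; exact: summable_condE_Linv.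
  by apply/funext => w; rewrite sub0r normrN.
move=> n.
rewrite (eq_bigr (fun k => (ip P (fun w => `|A k w|)%R (rho k))%:E)); last first.
  by move=> k _; rewrite ipE//; exact: L2_normr.
under eq_bigr do rewrite kolmogorov_remainder EFinD.
rewrite big_split /= leeD//.
- rewrite (@le_trans _ _ (\sum_(0 <= k < n) 2%:E * 'E_P[fun w => `|Dk k (DH k) w * B k w|%R]))//.
    apply: lee_sum => k _.
    rewrite (_ : (\int[P]_w _)%R = (\int[P]_w ((g (F w) - g (Ck k F w)) * (Dk k (DH k) w * B k w)))%R).
      apply: Rintegral_mul_bounded_le => [||w]; last exact: stein_gind_osc.
        by apply: L2_mul_integrable => //; exact: Dk_L2.
      by apply: measurable_funB; apply: measurableT_comp => //; exact: L2_measurable.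
    by apply: eq_Rintegral => w _; rewrite mulrC.
  rewrite -ge0_sume_distrr; last by move=> k _; exact: expectation_ge0.
  by rewrite lee_wpmul2l// nneseries_lim_ge// => k _ _; exact: expectation_ge0.
have icB k : P.-integrable [set: T] (EFin \o (fun w => c k w * B k w)%R).
  exact: L2_mul_integrable.
have igcB k : P.-integrable [set: T] (EFin \o (fun w => g (F w) * (c k w * B k w))%R).
  apply: le_integrable (integrableZl measurableT 2%R (icB k)) => // [|w _].
    apply/measurable_EFinP; apply: measurable_funM; first exact: measurableT_comp.
    by apply/measurable_EFinP; exact: measurable_int (icB k).
  rewrite -EFinM !abse_EFin lee_fin [leLHS]normrM [leRHS]normrM ler_wpM2r//.
  by rewrite (le_trans (stein_gind_le2 _ _))// ler_norm.
have [_ gE] := Rintegral_series n igcB; have [isc _] := Rintegral_series n icB.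
rewrite sumEFin -[X in X%:E]gE.
(* Only after [g (F w)] is factored out of the partial sum is it bounded by 2, so cancellation
   between the terms is kept. *)
rewrite (_ : (\int[P]_w _)%R = (\int[P]_w (g (F w) * series (fun k => c k w * B k w) n))%R).
  rewrite (le_trans (Rintegral_mul_bounded_le isc _ (fun w => stein_gind_le2 z (F w))))//.
    exact: measurableT_comp.
  rewrite le_eqVlt; apply/orP; left; apply/eqP; congr (_ * expectation _ _).
  by apply/funext => w; rewrite sub0r normrN.
by apply: eq_Rintegral => w _; rewrite /series /= mulr_sumr.
Qed.

End kolmogorov.

End bounds.

Theorem theorem3p5 (R : realType)
    (d : measure_display) (T : measurableType d) (P : probability T R)
    (dE : nat -> measure_display) (E : forall n, measurableType (dE n))
    (X : forall n, {RV P >-> E n}) (indX : independent_seq P X)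
    (F : T -> R) (domF : dom_D P X F) (EF0 : 'E_P[F] = 0)
    (LinvF : T -> R) (LinvFE : is_Linv P X F LinvF)
    (d' : measure_display) (T' : measurableType d') (Q : probability T' R)
    (Z : {RV Q >-> R})
    (lawZ : forall A : set R, measurable A -> distribution Q Z A = normal_prob 0 1 A) :
  dWasserstein P F Q Z <=
      (Num.sqrt (2 / pi))%:E *
        'E_P[fun w => `| 1 - limn (series (fun k =>
                Dk P X k (\- LinvF)%R w * Dk P X k F w)) |%R]
      + \sum_(k <oo) 'E_P[fun w =>
                (`| Dk P X k (\- LinvF)%R w | * Dk P X k F w ^+ 2)%R]
  /\
  dKolmogorov P F Q Z <=
      'E_P[fun w => `| 1 - limn (series (fun k =>
                Dk P X k (\- LinvF)%R w * Dk P X k F w)) |%R]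
      + 2%:E * \sum_(k <oo) 'E_P[fun w =>
                `| Dk P X k (fun v => `| Dk P X k LinvF v |) w
                   * Dk P X k F w |%R]
      + 2%:E * 'E_P[fun w => `| limn (series (fun k =>
                condE_G P X k (fun v => `| Dk P X k LinvF v |) w
                * Dk P X k F w)) |%R].
Proof.
have [_ LHF] := LinvFE; split; first exact: (wasserstein_bound domF LHF lawZ).
apply: ge_ereal_sup => _ [z _ <-].
by rewrite (probability_normal lawZ); exact: kolmogorov_bound_at.
Qed.
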